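(* Let $L$ and $M-L$ be (positive) even integers. Suppose $\mathcal S=\{\omega_1,\dots,\omega_s\}\subset[0,1)$ ($s\ge 2$ distinct frequencies) satisfies the gap condition $$q=\min_{j\neq l}d(\omega_j,\omega_l)>\max\left(\frac1L\sqrt{\frac2\pi}\Big(\frac2\pi-\frac4L\Big)^{-\frac12},\ \frac1{M-L}\sqrt{\frac2\pi}\Big(\frac2\pi-\frac4{M-L}\Big)^{-\frac12}\right)$$ (where it is understood that $\frac2\pi-\frac4L>0$ and $\frac2\pi-\frac4{M-L}>0$). Then for all $\omega\in[0,1)$, $$|R^\varepsilon(\omega)-R(\omega)|\le\frac{4\alpha_1+2\frac{\|E\|_2}{\sqrt{L(M-L)}}}{\left(\alpha_2-\frac{\|E\|_2}{\sqrt{L(M-L)}}\right)^2}\cdot\frac{\|E\|_2}{\sqrt{L(M-L)}}$$ (the right-hand side being read as $+\infty$ if its denominator vanishes), where $$\alpha_1=x_{\max}\sqrt{\Big(\frac{4\sqrt2}{\pi}+\frac{\sqrt2}{\pi L^2q^2}+\frac{3\sqrt2}{L}\Big)\Big(\frac{4\sqrt2}{\pi}+\frac{\sqrt2}{\pi(M-L)^2q^2}+\frac{3\sqrt2}{M-L}\Big)}$$ and $$\alpha_2=x_{\min}\sqrt{\Big(\frac2\pi-\frac{2}{\pi L^2q^2}-\frac4L\Big)\Big(\frac2\pi-\frac{2}{\pi(M-L)^2q^2}-\frac4{M-L}\Big)} .$$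
   Context: Setting. $d(\omega,\omega')=\min_{n\in\mathbb Z}|\omega+n-\omega'|$ is the metric of the torus $[0,1)$. Let $s,L,M$ be positive integers with $1\le L<M$. Let $\mathcal S=\{\omega_1,\dots,\omega_s\}\subset[0,1)$ be $s$ distinct frequencies and $x_1,\dots,x_s\in\mathbb C\setminus\{0\}$ amplitudes; $x_{\min}=\min_j|x_j|$, $x_{\max}=\max_j|x_j|$. Put $\phi^{L}(\omega)=[1,\ e^{-2\pi i\omega},\dots,e^{-2\pi iL\omega}]^T\in\mathbb C^{L+1}$. The noiseless data are $y_k=\sum_{j=1}^s x_je^{-2\pi ik\omega_j}$, $k=0,\dots,M$; $\varepsilon=(\varepsilon_k)_{k=0}^M\in\mathbb C^{M+1}$ is an arbitrary noise vector and $y^\varepsilon=y+\varepsilon$. For $v\in\mathbb C^{M+1}$, $\mathrm{Hankel}(v)\in\mathbb C^{(L+1)\times(M-L+1)}$ has entries $v_{a+b}$, $0\le a\le L$, $0\le b\le M-L$. Put $H=\mathrm{Hankel}(y)$, $E=\mathrm{Hankel}(\varepsilon)$, $H^\varepsilon=\mathrm{Hankel}(y^\varepsilon)=H+E$. Under the gap condition $s\le L$ and $s\le M-L$, and $H$ has rank $s$. Write singular value decompositions (singular values in nonincreasing order) $H=[U_1\ U_2]\,\mathrm{diag}(\sigma_1,\dots,\sigma_s,0,\dots,0)\,[V_1\ V_2]^\star$ with $\sigma_s>0$, and $H^\varepsilon=[U_1^\varepsilon\ U_2^\varepsilon]\,\mathrm{diag}(\sigma_1^\varepsilon,\sigma_2^\varepsilon,\dots)\,[V_1^\varepsilon\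 V_2^\varepsilon]^\star$, where $U_1,U_1^\varepsilon$ have $s$ columns and $U_2,U_2^\varepsilon$ have $L+1-s$ columns. Put $\mathcal P_2=U_2U_2^\star$, $\mathcal P_2^\varepsilon=U_2^\varepsilon(U_2^\varepsilon)^\star$ and $$R(\omega)=\frac{\|\mathcal P_2\phi^L(\omega)\|_2}{\|\phi^L(\omega)\|_2},\qquad R^\varepsilon(\omega)=\frac{\|\mathcal P^\varepsilon_2\phi^L(\omega)\|_2}{\|\phi^L(\omega)\|_2}.$$ $\|E\|_2$ is the spectral norm of $E$. *)

(* Defs.v *)
From mathcomp Require Import all_boot all_order all_algebra.
From mathcomp Require Import all_classical all_reals all_analysis.
From mathcomp Require Import complex.

Set Implicit Arguments.
Unset Strict Implicit.
Unset Printing Implicit Defensive.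

Import Order.TTheory GRing.Theory Num.Theory.
Local Open Scope classical_set_scope.
Local Open Scope ring_scope.
Local Open Scope complex_scope.
Local Open Scope sesquilinear_scope.

(* [`| z |] on R[i] is R[i]-valued; [cmod] is the real-valued modulus. *)
Definition cmod (R : realType) (z : R[i]) : R := Normc.normc z.

(* exp (- 2 pi i t) *)
Definition expm2pii (R : realType) (t : R) : R[i] :=
  cos (2 * pi * t) -i* sin (2 * pi * t).

(* The infima and suprema in [torus_dist], [separation], [amp_min] and
   [amp_max] are attained (for s >= 2 in [separation], s >= 1 in [amp_min] and
   [amp_max]), so they are minima and maxima. *)
Definition torus_dist (R : realType) (w w' : R) : R :=
  inf [set `| w + n%:~R - w' | | n in [set: int]].

Definition separation (R : realType) (s : nat) (omega : 'I_s -> R) : R :=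
  inf [set torus_dist (omega p.1) (omega p.2)
      | p in [set p : 'I_s * 'I_s | p.1 != p.2]].

Definition amp_min (R : realType) (s : nat) (x : 'I_s -> R[i]) : R :=
  inf (range (fun j => cmod (x j))).

Definition amp_max (R : realType) (s : nat) (x : 'I_s -> R[i]) : R :=
  sup (range (fun j => cmod (x j))).

Definition l2norm (R : realType) (n : nat) (v : 'cV[R[i]]_n) : R :=
  Num.sqrt (\sum_(i < n) cmod (v i 0) ^+ 2).

Definition spectral_norm (R : realType) (m n : nat) (A : 'M[R[i]]_(m, n)) : R :=
  sup [set l2norm (A *m v) | v in [set v : 'cV[R[i]]_n | l2norm v <= 1]].

Definition steering (R : realType) (L : nat) (w : R) : 'cV[R[i]]_L.+1 :=
  \col_(k < L.+1) expm2pii (k%:R * w).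

Definition clean_data (R : realType) (s M : nat) (omega : 'I_s -> R)
    (x : 'I_s -> R[i]) : 'cV[R[i]]_M.+1 :=
  \col_(k < M.+1) \sum_(j < s) x j * expm2pii (k%:R * omega j).

(* For L <= M the index a + b is at most M, so that [inord] does not
   truncate. *)
Definition hankel (R : realType) (L M : nat) (v : 'cV[R[i]]_M.+1) :
    'M[R[i]]_(L.+1, (M - L).+1) :=
  \matrix_(a < L.+1, b < (M - L).+1) v (inord (a + b)) 0.

(* Full singular value decomposition A = U diag(sigma) V^*; the singular values
   are indexed from 0, and only the first [minn m n] terms of [sigma] occur in
   the factorization (a finite list of singular values extends by zeros). *)
Definition is_svd (R : realType) (m n : nat) (A : 'M[R[i]]_(m, n))
    (U : 'M[R[i]]_m) (sigma : nat -> R) (V : 'M[R[i]]_n) : Prop :=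
  [/\ U \is unitarymx, V \is unitarymx,
      forall i, 0 <= sigma i,
      forall i j, (i <= j)%N -> sigma j <= sigma i &
      A = U *m (\matrix_(i < m, j < n)
                  if val i == val j then (sigma i)%:C else 0) *m V ^t*].

(* The columns s, ..., L of U, i.e. the block U_2 of U = [U_1 U_2], where U_1
   has s columns. *)
Definition noise_block (R : realType) (L s : nat) (U : 'M[R[i]]_L.+1) :
    'M[R[i]]_(L.+1, L.+1 - s) :=
  \matrix_(i < L.+1, j < L.+1 - s) U i (inord (s + j)).

Definition noise_proj (R : realType) (L s : nat) (U : 'M[R[i]]_L.+1) :
    'M[R[i]]_L.+1 :=
  noise_block s U *m (noise_block s U) ^t*.

(* The noise-space correlation function R(w) attached to the left singular
   vectors U. *)
Definition noise_corr (R : realType) (L s : nat) (U : 'M[R[i]]_L.+1) (w : R) :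
    R :=
  l2norm (noise_proj s U *m steering L w) / l2norm (steering L w).

Definition gap_threshold (R : realType) (L : nat) : R :=
  L%:R^-1 * Num.sqrt (2 / pi) * (2 / pi - 4 / L%:R) `^ (- 2^-1).

Definition ingham_upper (R : realType) (L : nat) (q : R) : R :=
  4 * Num.sqrt 2 / pi + Num.sqrt 2 / (pi * L%:R ^+ 2 * q ^+ 2)
  + 3 * Num.sqrt 2 / L%:R.

Definition ingham_lower (R : realType) (L : nat) (q : R) : R :=
  2 / pi - 2 / (pi * L%:R ^+ 2 * q ^+ 2) - 4 / L%:R.

Definition alpha1 (R : realType) (L N : nat) (q xmax : R) : R :=
  xmax * Num.sqrt (ingham_upper L q * ingham_upper N q).

Definition alpha2 (R : realType) (L N : nat) (q xmin : R) : R :=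
  xmin * Num.sqrt (ingham_lower L q * ingham_lower N q).

(* Main.v *)
Require Import Defs.
From mathcomp Require Import all_boot all_order all_algebra.
From mathcomp Require Import all_classical all_reals all_analysis.
From mathcomp Require Import complex ring lra zify.
Import Order.TTheory GRing.Theory Num.Theory numFieldNormedType.Exports.
Local Open Scope classical_set_scope.
Local Open Scope ring_scope.
Set Implicit Arguments.
Unset Strict Implicit.

(* The Hankel matrix factors as H = Phi_L diag(x) Phi_N^T with Vandermonde
   factors and N = M - L.  Weighting |sum_j c_j e^{-2 pi i k omega_j}|^2 by
   sin(pi k / L) turns its sum over k into a Hermitian form whose kernel decays
   quadratically; summing the kernel over a q-separated set gives Ingham's lower
   bound for |Phi_L c|^2, hence sigma_s >= alpha_2 sqrt(L N) =: tau.
   By Courant-Fischer, sigma_{s+1} = 0, sigma^eps_s >= tau - |E| and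
   sigma^eps_{s+1} <= |E|.  Writing the signal part of phi for one of the two
   matrices as an image A' v with |v| <= |phi| / sigma'_s and projecting it on
   the noise space of the other gives |R^eps - R| <= 2 |E| / (tau - |E|) when
   |E| < tau.  This is stronger than the claim because alpha_2 <= alpha_1, so
   no upper Ingham bound is needed; when |E| >= tau the right-hand side is at
   least 1 and R, R^eps lie in [0, 1]. *)

(** * Elementary trigonometric bounds *)

(** By the mean value theorem on [[0, x]]. Starting from [cos <= 1], three uses give the Taylor
    bounds below, each derivative being the preceding bound. *)
Lemma ge0_of_is_derive (R : realType) (f df : R -> R) :
  (forall x : R, is_derive x 1 f (df x)) -> (forall x, 0 < x -> 0 <= df x) ->
  f 0 = 0 -> forall x, 0 <= x -> 0 <= f x.
Proof.
move=> fd df0 f0 x; rewrite le_eqVlt => /predU1P[<-|x0]; first by rewrite f0.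
have cf : {within `[0, x], continuous f}.
  apply: continuous_subspaceT => y; apply: differentiable_continuous.
  by apply/derivable1_diffP; have [] := fd y.
have [c] := MVT x0 (fun y _ => fd y) cf.
rewrite in_itv/= f0 !subr0 => /andP[c0 _] ->.
by apply: mulr_ge0 (ltW x0); apply: df0.
Qed.

Lemma sin_le_id (R : realType) (x : R) : 0 <= x -> sin x <= x.
Proof.
move=> x0; rewrite -subr_ge0.
apply: (@ge0_of_is_derive R (fun y => y - sin y) (fun y => 1 - cos y)) x0.
- by move=> y _; rewrite subr_ge0 cos_le1.
- by rewrite sin0 subr0.
Qed.

Lemma cos_ge_quadratic (R : realType) (x : R) : 0 <= x -> 1 - x ^+ 2 / 2 <= cos x.
Proof.
move=> x0; rewrite -subr_ge0.
apply: (@ge0_of_is_derive R (fun y => cos y - (1 - y ^+ 2 / 2))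
  (fun y => y - sin y)) x0.
- move=> y; apply: is_derive_eq; rewrite /= ?/GRing.scale/=. by field.
- by move=> y y0; rewrite subr_ge0 sin_le_id // ltW.
- by rewrite cos0 expr0n /= mul0r subr0 subrr.
Qed.

Lemma sin_ge_cubic (R : realType) (x : R) : 0 <= x -> x - x ^+ 3 / 6 <= sin x.
Proof.
move=> x0; rewrite -subr_ge0.
apply: (@ge0_of_is_derive R (fun y => sin y - (y - y ^+ 3 / 6))
  (fun y => cos y - (1 - y ^+ 2 / 2))) x0.
- move=> y; apply: is_derive_eq; by rewrite /= ?/GRing.scale/=; field.
- by move=> y y0; rewrite subr_ge0 cos_ge_quadratic // ltW.
- by rewrite sin0 expr0n /= mul0r subr0 subrr.
Qed.

Lemma sin_sqrB (R : realType) (x d : R) :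
  sin x ^+ 2 - sin d ^+ 2 = sin (x - d) * sin (x + d).
Proof. by rewrite sinB sinD; have := cos2Dsin2 x; have := cos2Dsin2 d; nra. Qed.

(* [x] plays the role of [pi t] and [d] that of [pi / (2 L)]: the bound compares
   the discrete cosine kernel with its continuous analogue. *)
Lemma sin_cos_ratio_le (R : realType) (x d : R) :
  0 < d -> d <= 1 / 4 -> 2 * d <= x -> x <= pi / 2 ->
  0 < sin x ^+ 2 - sin d ^+ 2 /\
  sin d * cos d <=
    (d / (x ^+ 2 - d ^+ 2) + 8 / 5 * d) * (sin x ^+ 2 - sin d ^+ 2).
Proof.
move=> d0 d4 dx xpi; set D := sin x ^+ 2 - sin d ^+ 2; set X := x ^+ 2 - d ^+ 2.
have pi4 : pi / 2 < 2 :> R := pihalf_lt2 R.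
have pi1 : 1 <= pi / 2 :> R := pihalf_ge1 R.
have X0 : 0 < X by rewrite /X; nra.
have sd : sin d <= d by rewrite sin_le_id // ltW.
have sd0 : 0 < sin d by rewrite sin_gt0_pihalf // d0; lra.
(* As [sin d * cos d <= d], the claim follows once [X / D <= 1 + 8 / 5 * X]. *)
suff DX : 0 < D /\ X <= (1 + 8 / 5 * X) * D.
  case: DX => D0 DX; split=> //.
  apply: (@le_trans _ _ d).
    by have := cos_le1 d; nra.
  rewrite (_ : _ * D = d * ((1 + 8 / 5 * X) * D / X)); last first.
    by field; rewrite gt_eqF.
  by rewrite ler_peMr ?(ltW d0) // ler_pdivlMr // mul1r.
have [x1|x1] := lerP x 1.
  (* The product of the cubic bounds for [sin (x - d)] and [sin (x + d)] is [X * (1 - Y)] plus the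
     nonnegative remainder [X ^+ 3 / 36]. *)
  pose Y := (x ^+ 2 + d ^+ 2) / 3.
  have DY : X * (1 - Y) <= D.
    rewrite /D sin_sqrB.
    have a0 : 0 <= x - d by lra.
    have b0 : 0 <= x + d by lra.
    have := sin_ge_cubic a0; have := sin_ge_cubic b0.
    move: (sin (x + d)) (sin (x - d)) => sb sa hb ha.
    have aa : 0 <= (x - d) * (1 - (x - d) ^+ 2 / 6).
      by rewrite mulr_ge0 //; nra.
    have bb : 0 <= (x + d) * (1 - (x + d) ^+ 2 / 6).
      by rewrite mulr_ge0 //; nra.
    have ha' : (x - d) * (1 - (x - d) ^+ 2 / 6) <= sa by lra.
    have hb' : (x + d) * (1 - (x + d) ^+ 2 / 6) <= sb by lra.
    apply: le_trans (ler_pM aa bb ha' hb').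
    rewrite -subr_ge0 /X /Y.
    rewrite (_ : _ - _ = (x ^+ 2 - d ^+ 2) * (x - d) ^+ 2 * (x + d) ^+ 2 / 36).
      rewrite divr_ge0 // mulr_ge0 ?sqr_ge0 // mulr_ge0 ?sqr_ge0 //.
      exact: ltW X0.
    by field.
  (* From [d <= x / 2] and [x <= 1]. *)
  have Y7 : Y <= 5 / 12 by rewrite /Y; nra.
  have X34 : 3 / 4 * x ^+ 2 <= X by rewrite /X; nra.
  have YX : Y <= 8 / 5 * X * (1 - Y) by rewrite /Y in Y7 *; nra.
  have XY0 : 0 < X * (1 - Y) by nra.
  split; first exact: lt_le_trans DY.
  apply: (@le_trans _ _ ((1 + 8 / 5 * X) * (X * (1 - Y)))); last first.
    by rewrite ler_wpM2l //; lra.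
  by nra.
have s1 : 5 / 6 <= sin x.
  have s1 := @sin_ge_cubic R 1 ler01.
  apply: (@le_trans _ _ (sin 1)); first by lra.
  by apply/ltW; rewrite ltr_sin // in_itv /=; apply/andP; split; lra.
(* This explains the constant [8 / 5]: with [D >= 5 / 8], the right-hand side is at least
   [5 / 8 + X]. *)
have D5 : 5 / 8 <= D by rewrite /D; nra.
by split; [lra|nra].
Qed.

(** * Ingham's kernel *)

Section Modulus.
Variable R : realType.
Local Open Scope complex_scope.
Implicit Types (z w : R[i]) (t u : R).

Lemma cmod_ge0 z : 0 <= cmod z.
Proof. by case: z => a b; exact: sqrtr_ge0. Qed.

Lemma cmodM z w : cmod (z * w) = cmod z * cmod w.
Proof. exact: Normc.normcM. Qed.

Lemma cmod0 : cmod (0 : R[i]) = 0.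
Proof. exact: Normc.normc0. Qed.

Lemma sqr_cmodE z : cmod z ^+ 2 = complex.Re z ^+ 2 + complex.Im z ^+ 2.
Proof. by case: z => a b; rewrite /cmod /= sqr_sqrtr // addr_ge0 // sqr_ge0. Qed.

Lemma mulcE (a b c d : R) :
  (a +i* b) * (c +i* d) = (a * c - b * d) +i* (a * d + b * c).
Proof. by []. Qed.

Lemma sqr_cmodC z : (cmod z ^+ 2)%:C = z * z^*%C.
Proof.
rewrite sqr_cmodE; case: z => a b /=; rewrite mulcE.
by congr Complex; ring.
Qed.

Lemma cmod_real u : 0 <= u -> cmod u%:C = u.
Proof. by move=> u0; rewrite /cmod /= expr0n addr0 sqrtr_sqr ger0_norm. Qed.

Lemma cmodJ z : cmod z^*%C = cmod z.
Proof. by case: z => a b; rewrite /cmod /= sqrrN. Qed.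

Lemma cmodN z : cmod (- z) = cmod z.
Proof. by case: z => a b; rewrite /cmod /= !sqrrN. Qed.

Lemma ler_cmodD z w : cmod (z + w) <= cmod z + cmod w.
Proof. exact: le_normcD. Qed.

Lemma Re_le_cmod z : `|complex.Re z| <= cmod z.
Proof.
case: z => a b; rewrite /cmod /= -sqrtr_sqr ler_wsqrtr //.
by rewrite lerDl sqr_ge0.
Qed.

Lemma expm2piiD t u : expm2pii (t + u) = expm2pii t * expm2pii u.
Proof.
by rewrite /expm2pii mulrDr cosD sinD mulcE; congr Complex; ring.
Qed.

Lemma expm2pii0 : expm2pii (0 : R) = 1.
Proof. by rewrite /expm2pii mulr0 cos0 sin0 oppr0. Qed.

Lemma expm2piiN t : expm2pii (- t) = (expm2pii t)^*%C.
Proof. by rewrite /expm2pii mulrN cosN sinN. Qed.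

Lemma cmod_expm2pii t : cmod (expm2pii t) = 1.
Proof. by rewrite /cmod /= sqrrN cos2Dsin2 sqrtr1. Qed.

Lemma expm2piiX t n : expm2pii t ^+ n = expm2pii (n%:R * t).
Proof.
elim: n => [|n IH]; first by rewrite expr0 mul0r expm2pii0.
by rewrite exprS IH -expm2piiD -add1n natrD mulrDl mul1r.
Qed.

Lemma expm2pii_nat n : expm2pii (n%:R : R) = 1.
Proof.
rewrite -[n%:R]mulr1 -expm2piiX (_ : expm2pii 1 = 1) ?expr1n //.
by rewrite /expm2pii mulr1 mulrC mulr_natr cos2pi sin2pi oppr0.
Qed.

Lemma expm2pii_int (k : int) : expm2pii (k%:~R : R) = 1.
Proof.
case: k => n; first exact: expm2pii_nat.
by rewrite NegzE rmorphN /= expm2piiN expm2pii_nat conjc1.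
Qed.

(* The weights are the cosine window of length [L] recentred at [L / 2]. *)
Definition sin_kernel (L : nat) t : R[i] :=
  \sum_(k < L.+1) (sin (k%:R * (pi / L%:R)))%:C * expm2pii (k%:R * t).

(** The sines satisfy a three-term recurrence with characteristic polynomial
    [1 - 2 cos th z + z ^+ 2], so multiplying by it leaves only boundary terms. *)
Lemma sin_sumM (z : R[i]) (th : R) n :
  (\sum_(k < n.+1) (sin (k%:R * th))%:C * z ^+ k)
    * (1 - (2 * cos th)%:C * z + z ^+ 2)
  = z * (sin th)%:C - (sin (n.+1%:R * th))%:C * z ^+ n.+1
    + (sin (n%:R * th))%:C * z ^+ n.+2.
Proof.
elim: n => [|n IH].
  by rewrite big_ord1 !mul0r mul1r sin0 rmorph0 !mul0r expr1 addr0 mulrC subrr.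
rewrite big_ord_recr /= mulrDl {}IH.
have -> : sin (n.+2%:R * th)
    = 2 * cos th * sin (n.+1%:R * th) - sin (n%:R * th).
  have -> : n.+2%:R * th = n.+1%:R * th + th by rewrite -[n.+2]addn1 natrD; ring.
  have -> : n%:R * th = n.+1%:R * th - th by rewrite -[n.+1]addn1 natrD; ring.
  by rewrite sinD sinB; ring.
rewrite !(rmorphB, rmorphM) /= ![z ^+ _.+1]exprS.
by ring.
Qed.

(** At [th = pi / L] one has [sin (L th) = 0] and [sin ((L + 1) th) = - sin th], so only two
    boundary terms survive; a common factor [z] is then cancelled. *)
Lemma sin_kernelM L t : (0 < L)%N ->
  sin_kernel L t * (2 * (cos (2 * pi * t) - cos (pi / L%:R)))%:C
  = (sin (pi / L%:R))%:C * (1 + expm2pii (L%:R * t)).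
Proof.
move=> L0; set th := pi / _; set z := expm2pii t.
have Lth : L%:R * th = pi by rewrite /th mulrCA divff ?mulr1 // pnatr_eq0 -lt0n.
have z0 : z != 0.
  apply/eqP => z0; have := cmod_expm2pii t; rewrite -/z z0 cmod0 => /eqP.
  by rewrite eq_sym oner_eq0.
(* On the unit circle [z] plus its inverse is twice the real part. *)
have zz : 1 + z ^+ 2 = (2 * cos (2 * pi * t))%:C * z.
  have := cos2Dsin2 (2 * pi * t); rewrite /z /expm2pii expr2.
  move: (cos _) (sin _) => c s cs.
  rewrite !mulcE; apply/eqP; rewrite eq_complex /=.
  by apply/andP; split; apply/eqP; lra.
apply: (mulfI z0).
have -> : (sin th) = - sin (L.+1%:R * th).
  by rewrite -natr1 mulrDl Lth mul1r addrC sinDpi opprK.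
have := sin_sumM z th L.
have -> : (sin th) = - sin (L.+1%:R * th).
  by rewrite -natr1 mulrDl Lth mul1r addrC sinDpi opprK.
rewrite Lth sinpi rmorph0 mul0r addr0 (_ : 1 - _ + _ = (2 * cos (2 * pi * t) - 2 * cos th)%:C * z); last first.
  by rewrite rmorphB /= mulrBl -zz; ring.
have -> : \sum_(k < L.+1) (sin (k%:R * th))%:C * z ^+ k = sin_kernel L t.
  by apply: eq_bigr => k _; rewrite expm2piiX.
move=> E.
rewrite -expm2piiX -/z mulrBr !rmorphN /= in E *.
transitivity (sin_kernel L t * ((2 * cos (2 * pi * t) - 2 * cos th)%:C * z)).
  by rewrite mulrCA; congr (_ * _); rewrite mulrC.
by rewrite E exprS mulNr; ring.
Qed.

End Modulus.

(** * Size of the kernel at 0 and its quadratic decay *)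

Section Kernel.
Variable R : realType.
Local Open Scope complex_scope.

Lemma cos_doubleE (u : R) : cos (2 * u) = 1 - 2 * sin u ^+ 2.
Proof. by rewrite mulr_natl cos_mulr2n cos2sin2; ring. Qed.

Lemma sin_doubleE (u : R) : sin (2 * u) = 2 * (sin u * cos u).
Proof. by rewrite mulr_natl sin_mulr2n -mulr_natl; ring. Qed.

Section FixedOrder.
Variable L : nat.
Hypothesis L_gt0 : (0 < L)%N.
Hypothesis L_large : 2 * pi <= L%:R :> R.

Let pi0 : 0 < pi :> R := pi_gt0 R.
Let LR0 : 0 < L%:R :> R. Proof. by rewrite ltr0n. Qed.
(** Half of [pi / L]: the double-angle formula turns [cos (2 pi t) - cos (pi / L)] into twice
    [sin^2 d - sin^2 (pi t)]. The bound [2 pi <= L] means [d <= 1 / 4]. *)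
Let d : R := pi / (2 * L%:R).

Let d_gt0 : 0 < d.
Proof. by rewrite /d divr_gt0 // mulr_gt0. Qed.

Let d_le : d <= 1 / 4.
Proof. by rewrite /d ler_pdivrMr ?mulr_gt0 //; have := L_large; lra. Qed.

Let piLE : pi / L%:R = 2 * d.
Proof. by rewrite /d; move: (pi) => p; field; rewrite gt_eqF. Qed.

(** At [t = 0] the closed form is the cotangent of [d], which is at least [1 / d - d / 2]; here
    [1 / d = 2 L / pi] and [d / 2 <= 1 / 8]. *)
Lemma sin_kernel0_ge : 2 * L%:R / pi - 1 / 8 <= complex.Re (sin_kernel L (0 : R)).
Proof.
have /(congr1 (@complex.Re R)) := sin_kernelM (0 : R) L_gt0.
have := d_gt0; have := d_le; have := pi0; have := LR0 => LR pi00 dle dgt.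
rewrite !mulr0 expm2pii0 cos0 piLE cos_doubleE sin_doubleE.
case: (sin_kernel L 0) => T T' /=; rewrite !mulr0 !mul0r !subr0 => E.
have sd : sin d <= d by rewrite sin_le_id // ltW.
have sd0 : 0 < sin d.
  by rewrite sin_gt0_pihalf // d_gt0 /=; have := pihalf_ge1 R; lra.
have cd := cos_ge_quadratic (ltW d_gt0).
have Ts : T * sin d = cos d.
  by apply: (mulfI (lt0r_neq0 sd0)); lra.
have T0 : 0 <= T by rewrite -(pmulr_lge0 _ sd0) Ts; nra.
have Td : 1 - d ^+ 2 / 2 <= T * d by nra.
have -> : 2 * L%:R / pi = 1 / d.
  by rewrite /d; move: (pi) pi00 => p p0; field; rewrite !gt_eqF.
suff : 1 / d - d / 2 <= T by lra.
rewrite -(ler_pM2r d_gt0) (_ : _ * d = 1 - d ^+ 2 / 2) //.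
by field; rewrite gt_eqF.
Qed.

(** With [x = pi |t|], the closed form and [|1 + z^L| <= 2] bound the kernel by the ratio treated in
    [sin_cos_ratio_le]. Its main term is then made explicit through [|t| >= r q]. *)
Lemma sin_kernel_le (q t : R) (r : nat) :
  1 <= L%:R * q -> (0 < r)%N -> r%:R * q <= `|t| -> `|t| <= 1 / 2 ->
  cmod (sin_kernel L t) <=
    2 / (pi * L%:R * q ^+ 2) / (4 * r%:R ^+ 2 - 1) + 4 / 5 * pi / L%:R.
Proof.
have := d_gt0; have := d_le; have := pi0; have := LR0 => LR pi00 dle dgt.
move=> Lq r0 rt t2; set T := cmod _.
have r1 : 1 <= r%:R :> R by rewrite ler1n.
have q0 : 0 < q by rewrite -(pmulr_rgt0 _ LR0); lra.
have q_rq : q <= r%:R * q by rewrite ler_peMl // ltW.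
have Lt : 1 <= L%:R * `|t| by apply: le_trans Lq _; rewrite ler_pM2l //; lra.
pose x := pi * `|t|.
have dx : 2 * d <= x.
  by rewrite -piLE /x ler_pdivrMr // -mulrA ler_peMr ?(ltW pi00) // mulrC.
have xpi : x <= pi / 2 by rewrite /x ler_pM2l //; lra.
have [D0 SD] := sin_cos_ratio_le d_gt0 d_le dx xpi.
have TD : T * (sin x ^+ 2 - sin d ^+ 2) <= sin d * cos d.
  have /(congr1 (@cmod R)) := sin_kernelM t L_gt0.
  rewrite !cmodM -/T piLE.
  have -> : cos (2 * pi * t) = cos (2 * x).
    rewrite /x mulrA -[RHS]cos_norm -[LHS]cos_norm !normrM normr_id.
    by [].
  rewrite !cos_doubleE.
  have -> : 2 * (1 - 2 * sin x ^+ 2 - (1 - 2 * sin d ^+ 2))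
    = - (4 * (sin x ^+ 2 - sin d ^+ 2)) by ring.
  have sd0 : 0 <= sin (2 * d).
    by rewrite sin_ge0_pi //; have := pihalf_ge1 R; lra.
  have D40 : 0 <= 4 * (sin x ^+ 2 - sin d ^+ 2) by lra.
  rewrite rmorphN cmodN !cmod_real // sin_doubleE => E.
  have : cmod (1 + expm2pii (L%:R * t)) <= 2.
    have -> : 2 = cmod (1 : R[i]) + cmod (expm2pii (L%:R * t)).
      by rewrite cmod_expm2pii /cmod Normc.normc1.
    exact: ler_cmodD.
  move: E; rewrite sin_doubleE in sd0.
  rewrite -/(cmod _); move: (cmod (1 + _)) => m E m2.
  by nra.
have X0 : 0 < x ^+ 2 - d ^+ 2 by nra.
have T_le : T <= d / (x ^+ 2 - d ^+ 2) + 8 / 5 * d.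
  by rewrite -(ler_pM2r D0); apply: le_trans TD SD.
apply: le_trans T_le _; apply: lerD; last first.
  by rewrite le_eqVlt /d; apply/orP; left; apply/eqP; move: (pi) => p; field; rewrite gt_eqF.
have r41 : 0 < 4 * r%:R ^+ 2 - 1 :> R by nra.
(* Since [1 <= L q], replacing [d] by [d L q] only lowers the difference; with [d L = pi / 2] both
   squares become multiples of [q ^+ 2], which produces [4 r^2 - 1]. *)
have X_ge : d ^+ 2 * ((L%:R * q) ^+ 2 * (4 * r%:R ^+ 2 - 1)) <= x ^+ 2 - d ^+ 2.
  have dL : d * L%:R = pi / 2 by rewrite /d; move: (pi) => p; field; rewrite gt_eqF.
  have -> : d ^+ 2 * ((L%:R * q) ^+ 2 * (4 * r%:R ^+ 2 - 1))
     = (d * L%:R) ^+ 2 * (4 * (r%:R * q) ^+ 2) - (d * (L%:R * q)) ^+ 2 by ring.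
  rewrite dL; apply: lerB.
    rewrite (_ : _ * _ = (pi * (r%:R * q)) ^+ 2); last by field.
    rewrite /x ler_pXn2r ?nnegrE ?mulr_ge0 ?normr_ge0 ?(ltW pi00) ?(ltW q0) //.
    by rewrite ler_pM2l.
  rewrite ler_pXn2r ?nnegrE ?mulr_ge0 ?(ltW dgt) ?(ltW q0) ?(ltW pi00) //.
  by rewrite ler_peMr // ltW.
have Lq0 : 0 < L%:R * q by lra.
have P0 : 0 < d ^+ 2 * ((L%:R * q) ^+ 2 * (4 * r%:R ^+ 2 - 1)).
  by rewrite mulr_gt0 ?(exprn_gt0 _ dgt) ?mulr_gt0 ?(exprn_gt0 _ Lq0) ?r41.
apply: (@le_trans _ _ (d / (d ^+ 2 * ((L%:R * q) ^+ 2 * (4 * r%:R ^+ 2 - 1))))).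
  by apply: (ler_wpM2l (ltW dgt)); rewrite lef_pV2 ?posrE.
rewrite le_eqVlt; apply/orP; left; apply/eqP; rewrite /d.
by move: (pi) pi00 r41 => p p0 r41'; field; rewrite !gt_eqF.
Qed.

End FixedOrder.

(** Telescoping: each term is half of [1 / (2 r - 1) - 1 / (2 r + 1)]. *)
Lemma sum_inv_4sqrB1_le n :
  \sum_(1 <= r < n.+1) (4 * r%:R ^+ 2 - 1)^-1 <= 1 / 2 :> R.
Proof.
have -> : \sum_(1 <= r < n.+1) (4 * r%:R ^+ 2 - 1)^-1
    = 1 / 2 - (2 * (2 * n%:R + 1))^-1 :> R.
  elim: n => [|n IH]; first by rewrite big_geq // mulr0 add0r mulr1 div1r subrr.
  rewrite big_nat_recr //= IH -natr1; have n0 : 0 <= n%:R :> R by [].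
  by field; rewrite !gt_eqF //; nra.
rewrite lerBlDr lerDl invr_ge0.
have n0 : 0 <= n%:R :> R by [].
by lra.
Qed.

(** Each fibre of [r] has at most one index in [P], and the values missed by [r] contribute
    nonnegative terms. *)
Lemma ler_sum_inj (I : finType) (P : pred I) (r : I -> nat) (n : nat)
    (F : nat -> R) :
  {in P &, injective r} -> (forall i, P i -> 0 < r i <= n)%N ->
  (forall k, (0 < k)%N -> 0 <= F k) ->
  \sum_(i | P i) F (r i) <= \sum_(1 <= k < n.+1) F k.
Proof.
move=> rinj r1n F0.
have -> : \sum_(1 <= k < n.+1) F k = \sum_(k < n.+1 | (0 < k)%N) F k.
  by rewrite big_add1 /= big_mkord [RHS]big_mkcond big_ord_recl /= add0r.
rewrite (partition_big (fun i => inord (r i)) (fun k : 'I_n.+1 => (0 < k)%N)) /=; last first.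
  by move=> i /r1n/andP[r0 rn]; rewrite inordK.
apply: ler_sum => k k0.
have [/existsP[i0 /andP[Pi0 /eqP ik]]|] :=
  boolP [exists i, P i && (inord (r i) == k)]; last first.
  move=> /existsPn H; rewrite big1 ?F0 // => i; by rewrite (negbTE (H i)).
rewrite (big_pred1 i0) => [|i].
  by rewrite -ik inordK //; case/andP: (r1n _ Pi0).
apply/andP/eqP => [[Pi /eqP]|->]; last by rewrite Pi0 ik.
rewrite -ik => /(congr1 val); rewrite /= !inordK; first by apply: rinj.
  by case/andP: (r1n _ Pi0).
by case/andP: (r1n _ Pi).
Qed.

End Kernel.

(** * Row sums of the kernel and Ingham's lower bound *)

Section Ingham.
Variable R : realType.
Local Open Scope complex_scope.

Lemma conjcM (z w : R[i]) : (z * w)^*%C = z^*%C * w^*%C.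
Proof. exact: rmorphM. Qed.

Lemma conjc_sum (I : finType) (F : I -> R[i]) :
  (\sum_i F i)^*%C = \sum_i (F i)^*%C.
Proof. exact: rmorph_sum. Qed.

Lemma sin_kernelDz L (t : R) (n : int) :
  sin_kernel L (t + n%:~R) = sin_kernel L t.
Proof.
apply: eq_bigr => k _; rewrite mulrDr expm2piiD.
by rewrite (_ : _ * n%:~R = (k%:Z * n)%:~R) ?expm2pii_int ?mulr1 // intrM.
Qed.

Lemma cmod_sin_kernelN L (t : R) : cmod (sin_kernel L (- t)) = cmod (sin_kernel L t).
Proof.
rewrite -[RHS]cmodJ; congr cmod; rewrite /sin_kernel conjc_sum.
by apply: eq_bigr => k _; rewrite conjcM conjc_real -expm2piiN mulrN.
Qed.

Section RowSum.
Variables (L s : nat) (q : R) (omega : 'I_s -> R).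
Hypothesis L_gt0 : (0 < L)%N.
Hypothesis L_large : 2 * pi <= L%:R :> R.
Hypothesis Lq : 1 <= L%:R * q.
Hypothesis omega_sep : forall j l, j != l ->
  forall n : int, q <= `|omega j + n%:~R - omega l|.

(* Each difference is replaced by its representative [p] modulo 1 in
   [-1/2, 1/2] and labelled by [floor (|p| / q)], which is injective on each
   side of 0; [16 / 5] absorbs the discretization error of at most [L] terms,
   each at most [(4 pi / 5) / L]. *)
Lemma sin_kernel_row_sum_le (j : 'I_s) :
  \sum_(l < s | l != j) cmod (sin_kernel L (omega j - omega l))
    <= 2 / (pi * L%:R * q ^+ 2) + 16 / 5.
Proof.
have LR0 : 0 < L%:R :> R by rewrite ltr0n.
have q0 : 0 < q by rewrite -(pmulr_rgt0 _ LR0) (lt_le_trans ltr01).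
pose n l : int := - Num.floor (omega j - omega l + 1 / 2).
pose p l : R := omega j - omega l + (n l)%:~R.
have p2 l : `|p l| <= 1 / 2.
  have := Num.Theory.floor_le (omega j - omega l + 1 / 2).
  have := floorD1_gt (omega j - omega l + 1 / 2).
  rewrite /p /n rmorphN /= ler_norml intrD; move: (_%:~R) => fl h1 h2.
  by apply/andP; split; lra.
pose r l : nat := Num.truncn (`|p l| / q).
have pq0 l : 0 <= `|p l| / q by rewrite divr_ge0 ?(ltW q0).
have rp l : (r l)%:R * q <= `|p l|.
  by rewrite -ler_pdivlMr // -truncn_ge_nat.
have pr l : `|p l| < (r l).+1%:R * q.
  by rewrite -ltr_pdivrMr // -truncn_le_nat.
have r_gt0 l : l != j -> (0 < r l)%N.
  move=> lj; rewrite truncn_gt0 ler_pdivlMr // mul1r /p addrAC.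
  by apply: omega_sep; rewrite eq_sym.
(* [r q <= 1 / 2] and [1 <= L q] force [2 r <= L]. *)
have r_le l : (r l <= L./2)%N.
  rewrite -leq_double; suff : ((r l).*2 <= L)%N by lia.
  rewrite -(ler_nat R) -muln2 natrM.
  have rq2 : (r l)%:R * q <= 1 / 2 := le_trans (rp l) (p2 l).
  apply: (@le_trans _ _ (2 * ((r l)%:R * (L%:R * q)))).
    by rewrite mulrC ler_pM2l // ler_peMr.
  have -> : 2 * ((r l)%:R * (L%:R * q)) = L%:R * (2 * ((r l)%:R * q)) by ring.
  by rewrite ler_piMr ?(ltW LR0) //; lra.
(* Representatives of the same sign and label lie less than [q] apart, against the separation. *)
have r_inj l l' : (0 <= p l) = (0 <= p l') -> r l = r l' -> l = l'.
  move=> sgn rr; apply/eqP/negPn/negP => ll'.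
  have := omega_sep ll' (n l' - n l).
  have -> : omega l + (n l' - n l)%:~R - omega l' = p l' - p l.
    by rewrite /p rmorphB /=; ring.
  have := rp l; have := rp l'; have := pr l; have := pr l'.
  rewrite -rr -natr1; move: sgn; have [pl|pl] := lerP 0 (p l).
    move/esym => pl'; rewrite (ger0_norm pl) (ger0_norm pl') => *.
    suff : `|p l' - p l| < q by lra.
    by rewrite ltr_norml; apply/andP; split; lra.
  move/esym/negbT; rewrite -ltNge => pl'; rewrite (ltr0_norm pl) (ltr0_norm pl') => *.
  suff : `|p l' - p l| < q by lra.
  by rewrite ltr_norml; apply/andP; split; lra.
pose A : R := 2 / (pi * L%:R * q ^+ 2).
have A0 : 0 <= A.
  by rewrite /A divr_ge0 // !mulr_ge0 ?pi_ge0 ?(ltW q0) ?(ltW LR0).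
pose F (k : nat) : R := A / (4 * k%:R ^+ 2 - 1) + 4 / 5 * pi / L%:R.
have F0 k : (0 < k)%N -> 0 <= F k.
  move=> k0; have k1 : 1 <= k%:R :> R by rewrite ler1n.
  apply: addr_ge0; first by apply: divr_ge0 => //; nra.
  by apply: divr_ge0 (ltW LR0); rewrite !mulr_ge0 ?pi_ge0.
(* The telescoping sum gives [A / 2]; at most [L / 2] constant terms give [2 pi / 5 <= 8 / 5], as
   [pi < 4]. *)
have sumF : \sum_(1 <= k < (L./2).+1) F k <= A / 2 + 8 / 5.
  rewrite big_split /= -mulr_sumr; apply: lerD.
    by have := @sum_inv_4sqrB1_le R L./2 => /(ler_wpM2l A0); rewrite mul1r.
  rewrite big_const_nat subSS subn0 iter_addr addr0 -[leLHS]mulr_natl.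
  have : (L./2)%:R * 2 <= L%:R :> R.
    by rewrite -natrM ler_nat; lia.
  have := pihalf_lt2 R; have := pi_gt0 R.
  move: (pi) => P P0 P2 h.
  rewrite mulrA ler_pdivrMr //.
  by nra.
apply: (@le_trans _ _ (\sum_(l < s | l != j) F (r l))).
  apply: ler_sum => l lj; rewrite -(sin_kernelDz L _ (n l)).
  exact: (sin_kernel_le L_gt0 L_large Lq (r_gt0 l lj) (rp l) (p2 l)).
rewrite (bigID (fun l => 0 <= p l)) /=.
rewrite -/A (_ : A + 16 / 5 = (A / 2 + 8 / 5) + (A / 2 + 8 / 5)); last by lra.
apply: lerD; apply: le_trans sumF; apply: ler_sum_inj => //.
- by move=> l l' /andP[_ pl] /andP[_ pl'] /r_inj; apply; rewrite pl pl'.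
- by move=> l /andP[lj _]; rewrite r_gt0 ?r_le.
- move=> l l' /andP[_ pl] /andP[_ pl'] /r_inj; apply.
  by rewrite (negbTE pl) (negbTE pl').
- by move=> l /andP[lj _]; rewrite r_gt0 ?r_le.
Qed.

(** Diagonal dominance, as for Gershgorin discs: [2 |c_j| |c_l| <= |c_j|^2 + |c_l|^2] bounds each
    off-diagonal term, and the symmetry of [|K|] collects these bounds into row sums. *)
Lemma ler_hermitian_form (K : 'I_s -> 'I_s -> R[i]) (c : 'I_s -> R[i]) (k0 b : R) :
  (forall j, K j j = k0%:C) -> (forall j l, cmod (K j l) = cmod (K l j)) ->
  (forall j, \sum_(l < s | l != j) cmod (K j l) <= b) ->
  (k0 - b) * (\sum_j cmod (c j) ^+ 2)
    <= complex.Re (\sum_j \sum_l c j * (c l)^*%C * K j l).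
Proof.
move=> Kd Ksym Kb.
have ReD : {morph @complex.Re R : z w / z + w} by move=> [a a'] [e e'].
rewrite (big_morph _ ReD (erefl _)) mulrBl.
pose u j := cmod (c j) ^+ 2.
have off j l : - ((u j + u l) / 2 * cmod (K j l))
    <= complex.Re (c j * (c l)^*%C * K j l).
  apply: (@le_trans _ _ (- cmod (c j * (c l)^*%C * K j l))); last first.
    by have := Re_le_cmod (c j * (c l)^*%C * K j l); rewrite ler_norml => /andP[].
  rewrite lerN2 !cmodM cmodJ ler_wpM2r ?cmod_ge0 //.
  by rewrite /u; have := sqr_ge0 (cmod (c j) - cmod (c l)); lra.
have sym : \sum_j \sum_(l | l != j) (u j + u l) / 2 * cmod (K j l)
    = \sum_j u j * \sum_(l | l != j) cmod (K j l).
  pose S := \sum_j \sum_(l | l != j) u j * cmod (K j l).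
  have S' : S = \sum_j \sum_(l | l != j) u l * cmod (K j l).
    rewrite /S (exchange_big_dep xpredT) //=; apply: eq_bigr => j _.
    by apply: eq_big => [l|l _]; rewrite 1?eq_sym // Ksym.
  transitivity (S / 2 + S / 2).
    rewrite {2}S' /S !mulr_suml -big_split /=; apply: eq_bigr => j _.
    rewrite !mulr_suml -big_split /=; apply: eq_bigr => l _; ring.
  transitivity S; first by lra.
  by apply: eq_bigr => j _; rewrite mulr_sumr.
apply: (@le_trans _ _ (k0 * (\sum_j u j)
    - \sum_j \sum_(l | l != j) (u j + u l) / 2 * cmod (K j l))).
  apply: lerB => //; rewrite sym mulr_sumr; apply: ler_sum => j _.
  by rewrite mulrC ler_wpM2r ?sqr_ge0.
rewrite mulr_sumr -sumrB; apply: ler_sum => j _.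
rewrite (big_morph _ ReD (erefl _)) [leRHS](bigD1 j) //= -sumrN.
apply: lerD; last by apply: ler_sum => l _; exact: off.
by rewrite Kd -sqr_cmodC -rmorphM /= mulrC.
Qed.

End RowSum.

Lemma ler_ingham_lower (L s : nat) (q : R) (omega : 'I_s -> R) (c : 'I_s -> R[i]) :
  (0 < L)%N -> 2 * pi <= L%:R :> R -> 1 <= L%:R * q ->
  (forall j l, j != l -> forall n : int, q <= `|omega j + n%:~R - omega l|) ->
  L%:R * ingham_lower L q * (\sum_j cmod (c j) ^+ 2)
    <= \sum_(k < L.+1) cmod (\sum_j c j * expm2pii (k%:R * omega j)) ^+ 2.
Proof.
move=> L0 L_large Lq sep.
have LR0 : 0 < L%:R :> R by rewrite ltr0n.
have q0 : 0 < q by rewrite -(pmulr_rgt0 _ LR0) (lt_le_trans ltr01).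
pose w k : R := sin (k%:R * (pi / L%:R)).
pose f k := \sum_j c j * expm2pii (k%:R * omega j).
(* The weights are at most 1, so inserting them can only decrease the sum. *)
apply: (@le_trans _ _ (\sum_(k < L.+1) w k * cmod (f k) ^+ 2)); last first.
  by apply: ler_sum => k _; rewrite ler_piMl ?sqr_ge0 // sin_le1.
pose K j l := sin_kernel L (omega j - omega l).
have -> : \sum_(k < L.+1) w k * cmod (f k) ^+ 2
    = complex.Re (\sum_j \sum_l c j * (c l)^*%C * K j l).
  rewrite -[LHS]/(complex.Re (_ %:C)); congr complex.Re.
  rewrite rmorph_sum /=.
  transitivity (\sum_(k < L.+1) \sum_j \sum_l c j * (c l)^*%C *
      ((w k)%:C * expm2pii (k%:R * (omega j - omega l)))).
    apply: eq_bigr => k _; rewrite rmorphM /= sqr_cmodC /f conjc_sum.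
    rewrite mulr_suml mulr_sumr; apply: eq_bigr => j _.
    rewrite !mulr_sumr; apply: eq_bigr => l _.
    by rewrite conjcM mulrBr expm2piiD expm2piiN; ring.
  rewrite exchange_big /=; apply: eq_bigr => j _.
  rewrite exchange_big /=; apply: eq_bigr => l _.
  by rewrite -mulr_sumr.
have K0 j : K j j = (complex.Re (sin_kernel L (0 : R)))%:C.
  rewrite /K subrr.
  have -> : sin_kernel L (0 : R) = (\sum_(k < L.+1) w k)%:C.
    by rewrite rmorph_sum; apply: eq_bigr => k _; rewrite mulr0 expm2pii0 mulr1.
  by [].
have Ksym j l : cmod (K j l) = cmod (K l j).
  by rewrite /K -cmod_sin_kernelN opprB.
apply: le_trans (ler_hermitian_form c K0 Ksym (sin_kernel_row_sum_le L0 L_large Lq sep)).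
apply: ler_wpM2r; first by apply: sumr_ge0 => j _; exact: sqr_ge0.
(* The errors [1 / 8] on the diagonal and [16 / 5] off it add up to less than the 4 in
   [L * ingham_lower L q]. *)
have := sin_kernel0_ge L0 L_large; have := pi_gt0 R; rewrite /ingham_lower.
move: (complex.Re _) => T0; move: (pi) => P P0 hT.
have -> : L%:R * (2 / P - 2 / (P * L%:R ^+ 2 * q ^+ 2) - 4 / L%:R)
  = 2 * L%:R / P - 2 / (P * L%:R * q ^+ 2) - 4.
  by field; rewrite !gt_eqF.
by lra.
Qed.

End Ingham.

(** * Euclidean norms and rectangular diagonal matrices *)

Section L2.
Variable R : realType.
Local Open Scope complex_scope.
Local Open Scope sesquilinear_scope.
Local Notation C := R[i].

Definition nsq n (v : 'cV[C]_n) : R := \sum_(i < n) cmod (v i 0) ^+ 2.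

Lemma nsq_ge0 n (v : 'cV[C]_n) : 0 <= nsq v.
Proof. by apply: sumr_ge0 => i _; exact: sqr_ge0. Qed.

Lemma l2normE n (v : 'cV[C]_n) : l2norm v = Num.sqrt (nsq v).
Proof. by []. Qed.

Lemma l2norm_ge0 n (v : 'cV[C]_n) : 0 <= l2norm v.
Proof. exact: sqrtr_ge0. Qed.

Lemma sqr_l2norm n (v : 'cV[C]_n) : l2norm v ^+ 2 = nsq v.
Proof. by rewrite sqr_sqrtr // nsq_ge0. Qed.

Lemma l2norm0 n : l2norm (0 : 'cV[C]_n) = 0.
Proof.
rewrite l2normE /nsq big1 ?sqrtr0 // => i _.
by rewrite mxE cmod0 expr0n.
Qed.

Lemma nsq_gt0 n (v : 'cV[C]_n) : v != 0 -> 0 < nsq v.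
Proof.
move=> v0; rewrite lt_neqAle nsq_ge0 andbT eq_sym; apply: contra v0 => /eqP.
move=> /psumr_eq0P v0; apply/eqP/matrixP => i j; rewrite ord1 mxE.
have /eqP := v0 (fun i _ => sqr_ge0 _) i isT.
by rewrite sqrf_eq0 => /eqP /Normc.eq0_normc.
Qed.

Lemma le_l2norm m n (u : 'cV[C]_m) (v : 'cV[C]_n) (a : R) :
  0 <= a -> nsq u <= a ^+ 2 * nsq v -> l2norm u <= a * l2norm v.
Proof.
move=> a0 uv; rewrite -(@ler_pXn2r _ 2) // ?nnegrE ?mulr_ge0 ?l2norm_ge0 //.
by rewrite exprMn !sqr_l2norm.
Qed.

Lemma ge_l2norm m n (u : 'cV[C]_m) (v : 'cV[C]_n) (a : R) :
  0 <= a -> a ^+ 2 * nsq v <= nsq u -> a * l2norm v <= l2norm u.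
Proof.
move=> a0 uv; rewrite -(@ler_pXn2r _ 2) // ?nnegrE ?mulr_ge0 ?l2norm_ge0 //.
by rewrite exprMn !sqr_l2norm.
Qed.

(** Lagrange's identity: the double sum of squares is twice the difference of the two sides. *)
Lemma cauchy_schwarz_sum (I : finType) (a b : I -> R) :
  (\sum_i a i * b i) ^+ 2 <= (\sum_i a i ^+ 2) * (\sum_i b i ^+ 2).
Proof.
set A := \sum_i a i ^+ 2; set B := \sum_i b i ^+ 2; set P := \sum_i _.
have : 0 <= \sum_i \sum_j (a i * b j - a j * b i) ^+ 2.
  by apply: sumr_ge0 => i _; apply: sumr_ge0 => j _; exact: sqr_ge0.
have -> : \sum_i \sum_j (a i * b j - a j * b i) ^+ 2 = A * B + B * A - 2 * P ^+ 2.
  rewrite expr2 /A /B /P !mulr_suml mulr_sumr -big_split -sumrB /=.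
  apply: eq_bigr => i _.
  rewrite !mulr_sumr -big_split -sumrB /=.
  apply: eq_bigr => j _; ring.
by rewrite (mulrC B); lra.
Qed.

Lemma l2normD n (u v : 'cV[C]_n) : l2norm (u + v) <= l2norm u + l2norm v.
Proof.
rewrite -(@ler_pXn2r _ 2) // ?nnegrE ?addr_ge0 ?l2norm_ge0 //.
rewrite sqrrD !sqr_l2norm.
pose P := \sum_i cmod (u i 0) * cmod (v i 0).
have PP : P <= l2norm u * l2norm v.
  have P0 : 0 <= P by apply: sumr_ge0 => i _; rewrite mulr_ge0 ?cmod_ge0.
  rewrite -(@ler_pXn2r _ 2) // ?nnegrE ?mulr_ge0 ?l2norm_ge0 //.
  by rewrite exprMn !sqr_l2norm; exact: cauchy_schwarz_sum.
apply: (@le_trans _ _ (nsq u + P *+ 2 + nsq v)); last first.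
  by rewrite lerD2r lerD2l lerMn2r PP orbT.
rewrite /nsq /P -sumrMnl -!big_split /=; apply: ler_sum => i _.
rewrite mxE -sqrrD ler_pXn2r // ?nnegrE ?addr_ge0 ?cmod_ge0 //.
exact: ler_cmodD.
Qed.

Lemma l2normN n (v : 'cV[C]_n) : l2norm (- v) = l2norm v.
Proof. by congr Num.sqrt; apply: eq_bigr => i _; rewrite mxE cmodN. Qed.

Lemma conjCE (z : C) : (z^*)%R = z^*%C.
Proof. by []. Qed.

Lemma nsq_dot n (v : 'cV[C]_n) : (nsq v)%:C = (v ^t* *m v) 0 0.
Proof.
rewrite mxE rmorph_sum /=; apply: eq_bigr => i _.
by rewrite sqr_cmodC !mxE mulrC.
Qed.

Lemma trmxCM m n p (A : 'M[C]_(m, n)) (B : 'M[C]_(n, p)) :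
  (A *m B) ^t* = B ^t* *m A ^t*.
Proof. by rewrite trmx_mul map_mxM. Qed.

Lemma unitarymx_trC n (U : 'M[C]_n) : U \is unitarymx -> U ^t* *m U = 1%:M.
Proof. by move=> /unitarymxP /mulmx1C. Qed.

Lemma nsq_unitary n (U : 'M[C]_n) (v : 'cV[C]_n) :
  U \is unitarymx -> nsq (U *m v) = nsq v.
Proof.
move=> Uu; apply: (@complexI R).
by rewrite !nsq_dot trmxCM mulmxA -(mulmxA _ _ U) unitarymx_trC // mulmx1.
Qed.

(** The dimension count behind the Courant-Fischer arguments. *)
Lemma exists_ker_vector (F : fieldType) p q (A : 'M[F]_(p, q)) :
  (p < q)%N -> exists2 c : 'cV[F]_q, c != 0 & A *m c = 0.
Proof.
move=> pq; have : kermx A^T != 0.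
  rewrite kermx_eq0 -row_leq_rank -ltnNge mxrank_tr.
  exact: leq_ltn_trans (rank_leq_row A) pq.
move=> /rowV0Pn[r /sub_kermxP rA r0]; exists r^T; first by rewrite trmx_eq0.
by apply: trmx_inj; rewrite trmx_mul trmxK rA trmx0.
Qed.

(* Padding with zeros, so that rectangular diagonal matrices act by pointwise
   multiplication. *)
Definition ext n (v : 'cV[C]_n) (k : nat) : C := oapp (fun i => v i 0) 0 (insub k).

Lemma ext_ord n (v : 'cV[C]_n) (i : 'I_n) : ext v i = v i 0.
Proof. by rewrite /ext valK. Qed.

Lemma ext_out n (v : 'cV[C]_n) k : (n <= k)%N -> ext v k = 0.
Proof. by move=> nk; rewrite /ext insubF //= ltnNge nk. Qed.

Lemma ext_inj n (u v : 'cV[C]_n) : (forall k, ext u k = ext v k) -> u = v.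
Proof. by move=> uv; apply/matrixP => i j; rewrite ord1 -!ext_ord uv. Qed.

Lemma nsq_ext n N (v : 'cV[C]_n) : (n <= N)%N ->
  nsq v = \sum_(k < N) cmod (ext v k) ^+ 2.
Proof.
move=> nN; rewrite -(big_mkord xpredT (fun k => cmod (ext v k) ^+ 2)).
rewrite (big_cat_nat _ nN) //= big_mkord [X in _ + X]big_nat_cond [X in _ + X]big1 ?addr0.
  by apply: eq_bigr => i _; rewrite ext_ord.
by move=> k /andP[/andP[nk _] _]; rewrite ext_out // cmod0 expr0n.
Qed.

Lemma ext_mulmx m n (W : 'M[C]_(m, n)) (c : 'cV[C]_n) k :
  ext (W *m c) k = \sum_j ext (col j W) k * c j 0.
Proof.
have [km|mk] := ltnP k m.
  rewrite -[k]/(val (Ordinal km)) ext_ord mxE; apply: eq_bigr => j _.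
  by rewrite ext_ord mxE.
by rewrite ext_out // big1 // => j _; rewrite ext_out // mul0r.
Qed.

(** The middle factor of [is_svd] with an arbitrary symbol [f], so that noise projections and
    truncated pseudo-inverses have the same form. *)
Definition dmx m n (f : nat -> R) : 'M[C]_(m, n) :=
  \matrix_(i < m, j < n) if val i == val j then (f i)%:C else 0.

Lemma ext_dmx m n (f : nat -> R) (v : 'cV[C]_n) k :
  ext (dmx m n f *m v) k = if (k < m)%N then (f k)%:C * ext v k else 0.
Proof.
case: ifP => [km|/negbT]; last by rewrite -leqNgt => /ext_out ->.
rewrite -[k]/(val (Ordinal km)) ext_ord mxE /=.
have [kn|nk] := ltnP k n.
  rewrite (bigD1 (Ordinal kn)) //= mxE /= eqxx big1 ?addr0 => [|j jk].
    by rewrite -[k in ext v k]/(val (Ordinal kn)) ext_ord.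
  rewrite mxE /=; case: eqP => [kj|]; last by rewrite mul0r.
  by case/eqP: jk; apply: val_inj.
rewrite ext_out // mulr0 big1 // => j _; rewrite mxE /=.
by case: eqP => [kj|]; [have := ltn_ord j; rewrite -kj ltnNge nk|rewrite mul0r].
Qed.

(** Coordinates from [n] on are lost in the middle space, hence the side condition that the product
    of symbols vanishes there. *)
Lemma dmx_mul m n p (f g : nat -> R) (v : 'cV[C]_p) :
  (forall k, (n <= k)%N -> (k < m)%N -> (k < p)%N -> f k * g k = 0) ->
  dmx m n f *m (dmx n p g *m v) = dmx m p (fun k => f k * g k) *m v.
Proof.
move=> fg0; apply: ext_inj => k; rewrite !ext_dmx; case: ifP => // km.
case: ifP => [kn|/negbT]; first by rewrite rmorphM mulrA.
rewrite -leqNgt mulr0 => nk; have [kp|pk] := ltnP k p.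
  by rewrite fg0 // mul0r.
by rewrite ext_out ?mulr0.
Qed.

(** Restricting the bound to the support of [v] lets orthogonality to leading singular vectors be
    exploited. *)
Lemma nsq_dmx_le m n (f : nat -> R) (v : 'cV[C]_n) (a : R) :
  (forall k, (k < m)%N -> (k < n)%N -> ext v k != 0 -> `|f k| <= a) ->
  nsq (dmx m n f *m v) <= a ^+ 2 * nsq v.
Proof.
move=> fa; rewrite (nsq_ext _ (leq_addr n m)) (nsq_ext _ (leq_addl m n)).
rewrite mulr_sumr; apply: ler_sum => k _; rewrite ext_dmx.
case: ifP => [km|_]; last by rewrite cmod0 expr0n mulr_ge0 ?sqr_ge0.
have [->|vk] := eqVneq (ext v k) 0; first by rewrite mulr0 cmod0 expr0n mulr0.
have [kn|nk] := ltnP k n; last by rewrite ext_out // eqxx in vk.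
rewrite cmodM exprMn ler_wpM2r ?sqr_ge0 // sqr_cmodE /= expr0n addr0.
have fk := fa _ km kn vk.
by rewrite -(real_normK (num_real (f k))) ler_pXn2r ?nnegrE // (le_trans _ fk).
Qed.

Lemma nsq_dmx_ge m n (f : nat -> R) (v : 'cV[C]_n) (a : R) :
  (forall k, (k < n)%N -> ext v k != 0 -> (k < m)%N /\ a <= f k) -> 0 <= a ->
  a ^+ 2 * nsq v <= nsq (dmx m n f *m v).
Proof.
move=> fa a0; rewrite (nsq_ext _ (leq_addr n m)) (nsq_ext _ (leq_addl m n)).
rewrite mulr_sumr; apply: ler_sum => k _; rewrite ext_dmx.
have [->|vk] := eqVneq (ext v k) 0.
  by rewrite mulr0 if_same cmod0 expr0n mulr0.
have [kn|nk] := ltnP k n; last by rewrite ext_out // eqxx in vk.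
have [-> fk] := fa _ kn vk.
rewrite cmodM exprMn ler_wpM2r ?sqr_ge0 // sqr_cmodE /= expr0n addr0.
by rewrite ler_pXn2r ?nnegrE // (le_trans a0).
Qed.

End L2.

(** * Singular values and noise projections *)

Section SVD.
Variable R : realType.
Local Open Scope complex_scope.
Local Open Scope sesquilinear_scope.
Local Notation C := R[i].

Lemma svd_dmx m n (A : 'M[C]_(m, n)) U sigma V :
  is_svd A U sigma V -> A = U *m dmx m n sigma *m V ^t*.
Proof. by case. Qed.

Lemma trC_unitary n (V : 'M[C]_n) : V \is unitarymx -> V ^t* \is unitarymx.
Proof. by rewrite trmxC_unitary. Qed.

(* Some [B c] with [c != 0] is orthogonal to the first [s] right singular
   vectors. *)
Lemma singular_value_ge m n s (A : 'M[C]_(m, n)) U sigma V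
    (B : 'M[C]_(n, s.+1)) (tau : R) :
  is_svd A U sigma V ->
  (forall c : 'cV[C]_s.+1, c != 0 -> B *m c != 0) ->
  (forall c : 'cV[C]_s.+1, tau * l2norm (B *m c) <= l2norm (A *m (B *m c))) ->
  tau <= sigma s.
Proof.
move=> svdA Binj Atau; have [Uu Vu s0 smon _] := svdA.
pose W := V ^t* *m B.
pose K : 'M[C]_(s, s.+1) := \matrix_(i, j) ext (col j W) i.
have [c c0 Kc] := exists_ker_vector K (ltnSn s).
have Wc k : (k < s)%N -> ext (W *m c) k = 0.
  move=> ks; rewrite ext_mulmx; move/matrixP: Kc => /(_ (Ordinal ks) 0).
  by rewrite mxE [in RHS]mxE => Kc; rewrite -[RHS]Kc; apply: eq_bigr => j _; rewrite mxE.
have w0 : 0 < l2norm (B *m c) by rewrite sqrtr_gt0 nsq_gt0 // Binj.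
rewrite -(ler_pM2r w0); apply: le_trans (Atau c) _.
apply: le_l2norm => //.
have -> : A *m (B *m c) = U *m (dmx m n sigma *m (W *m c)).
  by rewrite {1}(svd_dmx svdA) /W !mulmxA.
rewrite (nsq_unitary _ Uu) -(nsq_unitary (B *m c) (trC_unitary Vu)) mulmxA.
apply: nsq_dmx_le => k _ _; case: (ltnP k s) => [/Wc ->|sk _]; first by rewrite eqxx.
by rewrite ger0_norm // smon.
Qed.

(* The kernel of [K] meets the span of the first [s + 1] right singular
   vectors. *)
Lemma singular_value_le m n s (A : 'M[C]_(m, n)) U sigma V
    (K : 'M[C]_(s, n)) (rho : R) k :
  is_svd A U sigma V ->
  (forall w : 'cV[C]_n, K *m w = 0 -> l2norm (A *m w) <= rho * l2norm w) ->
  (s <= k)%N -> (k < m)%N -> (k < n)%N -> sigma k <= rho.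
Proof.
move=> svdA Arho sk km kn; have [Uu Vu s0 smon _] := svdA.
pose J : 'M[C]_(n, s.+1) := dmx n s.+1 (fun=> 1).
have [c c0 Kc] := exists_ker_vector (K *m V *m J) (ltnSn s).
apply: (le_trans (smon _ _ sk)).
have sn : (s < n)%N := leq_ltn_trans sk kn.
have sm : (s < m)%N := leq_ltn_trans sk km.
pose w := V *m (J *m c).
have nw : nsq w = nsq (J *m c) by rewrite nsq_unitary.
have w0 : 0 < l2norm w.
  rewrite sqrtr_gt0 -/(nsq _) nw; apply: (@lt_le_trans _ _ (1 ^+ 2 * nsq c)).
    by rewrite expr1n mul1r nsq_gt0.
  by apply: nsq_dmx_ge => // i i_s _; rewrite (leq_trans i_s).
have Kw : K *m w = 0 by rewrite /w !mulmxA.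
rewrite -(ler_pM2r w0); apply: le_trans (Arho w Kw).
rewrite -(@ler_pXn2r _ 2) ?nnegrE ?mulr_ge0 ?l2norm_ge0 //.
rewrite exprMn !sqr_l2norm nw.
have -> : A *m w = U *m (dmx m n sigma *m (J *m c)).
  rewrite (svd_dmx svdA) /w -!mulmxA; congr (_ *m (_ *m _)).
  by rewrite mulmxA unitarymx_trC // mul1mx.
rewrite (nsq_unitary _ Uu); apply: nsq_dmx_ge => // i i_n.
rewrite ext_dmx i_n; have [i_s _|si] := ltnP i s.+1.
  by rewrite (leq_trans i_s) // smon.
by rewrite ext_out // mulr0 eqxx.
Qed.

Lemma noise_projE L s (U : 'M[C]_L.+1) :
  noise_proj s U = U *m dmx L.+1 L.+1 (fun k => (s <= k)%:R) *m U ^t*.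
Proof.
apply/matrixP => i k; rewrite !mxE.
pose F (l : 'I_L.+1) := U i l * (U k l)^*%C.
transitivity (\sum_(l < L.+1 | (s <= l)%N) F l).
  pose G l := F (inord l).
  transitivity (\sum_(0 <= j < L.+1 - s) G (s + j)%N).
    by rewrite big_mkord; apply: eq_bigr => j _; rewrite !mxE.
  (* For [s > L + 1] the truncated difference is 0 and both sums are empty. *)
  have [sL|Ls] := leqP s L.+1; last first.
    rewrite big_geq ?leqn0 ?subn_eq0 1?ltnW // big1 // => l sl.
    by have := ltn_ord l; lia.
  transitivity (\sum_(s <= l < L.+1) G l).
    by rewrite -[s in RHS]add0n big_addn; apply: eq_bigr => j _; rewrite addnC.
  rewrite big_nat_cond; transitivity (\sum_(0 <= l < L.+1 | (s <= l)%N) G l).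
    rewrite [RHS](big_cat_nat _ sL) //= [X in X + _]big_nat_cond.
    rewrite [X in X + _]big1 ?add0r; last by move=> l; lia.
    rewrite [RHS]big_nat_cond; apply: eq_bigl => l; lia.
  by rewrite big_mkord; apply: eq_bigr => l _; rewrite /G inord_val.
rewrite big_mkcond; apply: eq_bigr => l _; rewrite !mxE.
rewrite (bigD1 l) //= !mxE eqxx big1 ?addr0 => [|j jl]; last first.
  by rewrite !mxE; case: eqP => [/val_inj/eqP|]; rewrite ?(negbTE jl) ?mulr0.
by rewrite /F; case: (s <= l)%N; rewrite ?mulr1 ?mulr0 ?mul0r.
Qed.

Lemma noise_projM L s (U : 'M[C]_L.+1) (v : 'cV[C]_L.+1) :
  noise_proj s U *m v =
  U *m (dmx L.+1 L.+1 (fun k => (s <= k)%:R) *m (U ^t* *m v)).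
Proof. by rewrite noise_projE !mulmxA. Qed.

Lemma l2norm_noise_proj_le L s (U : 'M[C]_L.+1) (v : 'cV[C]_L.+1) :
  U \is unitarymx -> l2norm (noise_proj s U *m v) <= l2norm v.
Proof.
move=> Uu; rewrite -[leRHS]mul1r; apply: le_l2norm => //.
rewrite noise_projM (nsq_unitary _ Uu) -(nsq_unitary v (trC_unitary Uu)).
by apply: nsq_dmx_le => k _ _ _; case: (s <= k)%N; rewrite ?normr1 ?normr0.
Qed.

(* The part of [phi] outside the noise space of [A'] is [A' v] with
   [|v| <= |phi| / tau]; it is nearly annihilated by the noise projection of
   [A] because [A' v = A v + (A' - A) v]. *)
Lemma noise_proj_perturbation L n s (A A' : 'M[C]_(L.+1, n))
    U sigma V U' sigma' V' (tau rho e : R) (phi : 'cV[C]_L.+1) :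
  is_svd A U sigma V -> is_svd A' U' sigma' V' ->
  (s < n)%N -> 0 < tau -> tau <= sigma' s ->
  0 <= rho ->
  (forall k, (s < k)%N -> (k < L.+1)%N -> (k < n)%N -> sigma k <= rho) ->
  (forall v : 'cV[C]_n, l2norm ((A' - A) *m v) <= e * l2norm v) -> 0 <= e ->
  l2norm (noise_proj s.+1 U *m phi)
    <= l2norm (noise_proj s.+1 U' *m phi) + (rho + e) / tau * l2norm phi.
Proof.
move=> svdA svdA' sn tau0 tau_le rho0 srho Ee e0.
have [Uu Vu s0 smon _] := svdA; have [Uu' Vu' s0' smon' _] := svdA'.
set P := noise_proj s.+1 U; set P' := noise_proj s.+1 U'.
pose y := U' ^t* *m phi.
(* Symbol of the pseudo-inverse of [A'] truncated to its first [s + 1] singular values, which are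
   positive because [tau <= sigma' s]. *)
pose f k : R := if (k <= s)%N then (sigma' k)^-1 else 0.
pose v := V' *m (dmx n L.+1 f *m y).
have sig0 k : (k <= s)%N -> 0 < sigma' k.
  by move=> ks; apply: lt_le_trans (smon' _ _ ks); apply: lt_le_trans tau_le.
have phiE : phi = P' *m phi + A' *m v.
  rewrite /P' noise_projM (svd_dmx svdA') /v -!mulmxA.
  rewrite (mulmxA (V' ^t*)) unitarymx_trC // mul1mx -mulmxDr.
  rewrite dmx_mul => [|k nk _ _]; last first.
    by rewrite /f leqNgt (leq_trans sn nk) mulr0.
  have <- : y = dmx L.+1 L.+1 (fun k => (s < k)%:R) *m y
      + dmx L.+1 L.+1 (fun k => sigma' k * f k) *m y.
    apply: ext_inj => k.
    have extD (a b : 'cV[C]_L.+1) : ext (a + b) k = ext a k + ext b k.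
      by rewrite /ext; case: insub => [i|] /=; rewrite ?mxE ?addr0.
    rewrite extD !ext_dmx; case: ifP => [kL|/negbT]; last first.
      by rewrite -leqNgt addr0 => /ext_out.
    rewrite /f ltnNge; case: (leqP k s) => [/sig0 /lt0r_neq0 sk|_] /=.
      by rewrite divff // mul0r add0r mul1r.
    by rewrite mulr0 mul1r mul0r addr0.
  rewrite /y mulmxA.
  by have /unitarymxP -> := Uu'; rewrite mul1mx.
have nv : l2norm v <= tau^-1 * l2norm phi.
  apply: le_l2norm; first by rewrite invr_ge0 ltW.
  rewrite /v (nsq_unitary _ Vu') -(nsq_unitary phi (trC_unitary Uu')).
  apply: nsq_dmx_le => k _ _ _; rewrite /f; case: leqP => [ks|_].
    have := sig0 _ ks => sk; rewrite ger0_norm ?invr_ge0 ?(ltW sk) //.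
    by rewrite lef_pV2 ?posrE // (le_trans tau_le) // smon'.
  by rewrite normr0 invr_ge0 ltW.
(* The projection keeps only the singular values of [A] of index above [s]. *)
have PAv : l2norm (P *m (A *m v)) <= rho * l2norm v.
  apply: le_l2norm => //; rewrite noise_projM (nsq_unitary _ Uu).
  rewrite (svd_dmx svdA) -!mulmxA (mulmxA (U ^t*)) unitarymx_trC // mul1mx.
  rewrite dmx_mul => [|k Lk]; last by rewrite ltnNge Lk.
  rewrite -(nsq_unitary v (trC_unitary Vu)); apply: nsq_dmx_le => k kL kn _.
  have [ks|sk] := leqP k s; first by rewrite mul0r normr0.
  by rewrite mul1r ger0_norm // srho.
have PEv : l2norm (P *m ((A' - A) *m v)) <= e * l2norm v.
  exact: le_trans (l2norm_noise_proj_le _ _ Uu) (Ee v).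
rewrite {1}phiE mulmxDr; apply: le_trans (l2normD _ _) _.
apply: lerD; first exact: l2norm_noise_proj_le.
rewrite (_ : A' = A + (A' - A)); last by rewrite addrC subrK.
rewrite mulmxDl mulmxDr; apply: le_trans (l2normD _ _) _.
apply: le_trans (lerD PAv PEv) _; rewrite -mulrDl -mulrA.
by apply: ler_wpM2l nv; rewrite addr_ge0.
Qed.

(** The Frobenius norm is such a constant, by Cauchy-Schwarz on each row; this makes the supremum in
    [spectral_norm] one of a bounded set. *)
Lemma l2norm_mulmx_bounded m n (A : 'M[C]_(m, n)) :
  exists2 K : R, 0 <= K & forall v : 'cV[C]_n, l2norm (A *m v) <= K * l2norm v.
Proof.
pose K := \sum_i \sum_j cmod (A i j) ^+ 2.
have K0 : 0 <= K by do 2!apply: sumr_ge0 => ? _; exact: sqr_ge0.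
exists (Num.sqrt K) => [|v]; first exact: sqrtr_ge0.
apply: le_l2norm; first exact: sqrtr_ge0.
rewrite sqr_sqrtr // /K mulr_suml; apply: ler_sum => i _; rewrite mxE.
apply: le_trans (cauchy_schwarz_sum (fun j => cmod (A i j)) (fun j => cmod (v j 0))).
rewrite ler_pXn2r ?nnegrE ?cmod_ge0 //; last first.
  by apply: sumr_ge0 => j _; rewrite mulr_ge0 ?cmod_ge0.
elim/big_ind2: _ => [|z a w b za wb|j _]; first by rewrite cmod0.
  exact: le_trans (ler_cmodD _ _) (lerD za wb).
by rewrite cmodM.
Qed.

Lemma l2normZ n (a : R) (v : 'cV[C]_n) : 0 <= a ->
  l2norm (a%:C *: v) = a * l2norm v.
Proof.
move=> a0; rewrite -[a in RHS]ger0_norm // -sqrtr_sqr -sqrtrM ?sqr_ge0 //.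
congr Num.sqrt; rewrite mulr_sumr; apply: eq_bigr => i _.
by rewrite mxE cmodM cmod_real // exprMn.
Qed.

Lemma spectral_norm_has_ubound m n (A : 'M[C]_(m, n)) :
  has_ubound [set l2norm (A *m v) | v in [set v : 'cV[C]_n | l2norm v <= 1]].
Proof.
have [K K0 AK] := l2norm_mulmx_bounded A.
exists K => _ [v /= v1 <-]; apply: le_trans (AK v) _.
by rewrite ler_piMr.
Qed.

Lemma spectral_norm_ge0 m n (A : 'M[C]_(m, n)) : 0 <= spectral_norm A.
Proof.
apply: ub_le_sup; first exact: spectral_norm_has_ubound.
by exists 0; rewrite /= ?mulmx0 l2norm0.
Qed.

Lemma l2norm_mulmx_le m n (A : 'M[C]_(m, n)) v :
  l2norm (A *m v) <= spectral_norm A * l2norm v.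
Proof.
have [v0|v0] := eqVneq v 0; first by rewrite v0 mulmx0 !l2norm0 mulr0.
have nv : 0 < l2norm v by rewrite sqrtr_gt0 nsq_gt0.
rewrite -ler_pdivrMr // mulrC -l2normZ ?invr_ge0 ?l2norm_ge0 // scalemxAr.
apply: ub_le_sup; first exact: spectral_norm_has_ubound.
exists ((l2norm v)^-1%:C *: v) => //=.
by rewrite l2normZ ?invr_ge0 ?l2norm_ge0 // mulVf ?gt_eqF.
Qed.

End SVD.

(** * Hankel matrices of exponential sums *)

Section Hankel.
Variable R : realType.
Local Open Scope complex_scope.
Local Open Scope sesquilinear_scope.
Local Notation C := R[i].

Definition vandermonde s n (omega : 'I_s -> R) : 'M[C]_(n.+1, s) :=
  \matrix_(k < n.+1, j < s) expm2pii (k%:R * omega j).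

Lemma hankelD L M (u v : 'cV[C]_M.+1) :
  hankel L (u + v) = hankel L u + hankel L v.
Proof. by apply/matrixP => a b; rewrite !mxE. Qed.

Lemma hankel_clean s L M (omega : 'I_s -> R) (x : 'I_s -> C) : (L <= M)%N ->
  hankel L (clean_data M omega x) =
  vandermonde L omega *m diag_mx (\row_j x j) *m (vandermonde (M - L) omega)^T.
Proof.
move=> LM; rewrite mul_mx_diag; apply/matrixP => a b; rewrite !mxE inordK; last first.
  by have := ltn_ord a; have := ltn_ord b; lia.
apply: eq_bigr => j _; rewrite !mxE natrD mulrDl expm2piiD.
by rewrite mulrA (mulrC (x j)).
Qed.

Lemma nsq_conj n (v : 'cV[C]_n) : nsq (map_mx Num.conj v) = nsq v.
Proof. by apply: eq_bigr => i _; rewrite mxE conjCE cmodJ. Qed.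

(* [|B c|^2 = <c, B^* B c>], so a lower bound for [B] transfers to [B^*] on the
   range of [B]. *)
Lemma nsq_adjoint_ge m n (B : 'M[C]_(m, n)) (mu : R) (c : 'cV[C]_n) :
  0 < mu -> mu * nsq c <= nsq (B *m c) ->
  mu * nsq (B *m c) <= nsq (B ^t* *m (B *m c)).
Proof.
move=> mu0 Bmu; set y := B ^t* *m _.
pose P := \sum_i cmod (c i 0) * cmod (y i 0).
have BP : nsq (B *m c) <= P.
  rewrite -[nsq _]/(complex.Re (nsq (B *m c))%:C) nsq_dot trmxCM -mulmxA -/y.
  apply: le_trans (ler_norm _) _; apply: le_trans (Re_le_cmod _) _.
  rewrite mxE /P; elim/big_ind2: _ => [|z a w b za wb|j _]; first by rewrite cmod0.
    exact: le_trans (ler_cmodD _ _) (lerD za wb).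
  by rewrite cmodM !mxE conjCE cmodJ.
(* Expand [(mu |c_i| - |y_i|)^2 >= 0]; one [mu |B c|^2] is then absorbed through
   [mu |c|^2 <= |B c|^2]. *)
have P2 : 2 * mu * P <= mu ^+ 2 * nsq c + nsq y.
  rewrite /P /nsq !mulr_sumr -big_split /=; apply: ler_sum => i _.
  by have := sqr_ge0 (mu * cmod (c i 0) - cmod (y i 0)); lra.
have : mu * (mu * nsq c) <= mu * nsq (B *m c) by rewrite ler_wpM2l // ltW.
have : mu * nsq (B *m c) <= mu * P by rewrite ler_wpM2l // ltW.
by lra.
Qed.

Section SeparatedFrequencies.
Variables (s : nat) (q : R) (omega : 'I_s -> R).
Hypothesis omega_sep : forall j l, j != l ->
  forall n : int, q <= `|omega j + n%:~R - omega l|.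

Lemma nsq_vandermonde_ge L (c : 'cV[C]_s) :
  (0 < L)%N -> 2 * pi <= L%:R :> R -> 1 <= L%:R * q ->
  L%:R * ingham_lower L q * nsq c <= nsq (vandermonde L omega *m c).
Proof.
move=> L0 Ll Lq.
have := ler_ingham_lower (fun j => c j 0) L0 Ll Lq omega_sep.
congr (_ <= _); apply: eq_bigr => k _; congr (cmod _ ^+ 2).
by rewrite mxE; apply: eq_bigr => j _; rewrite mxE mulrC.
Qed.

(** The adjoint of the transpose is the entrywise conjugate, so the bound for the conjugate vector
    applies. *)
Lemma nsq_conj_vandermonde_ge L (c : 'cV[C]_s) :
  (0 < L)%N -> 2 * pi <= L%:R :> R -> 1 <= L%:R * q ->
  L%:R * ingham_lower L q * nsq c <= nsq (((vandermonde L omega)^T) ^t* *m c).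
Proof.
move=> L0 Ll Lq; rewrite trmxK -nsq_conj -[leRHS]nsq_conj map_mxM.
rewrite -map_mx_comp (eq_map_mx_id _ (@conjCK _)).
exact: nsq_vandermonde_ge.
Qed.

End SeparatedFrequencies.

(** Squared, the gap condition reads [2 / pi < (L q)^2 b] with [b = 2 / pi - 4 / L]. This is
    positivity of [ingham_lower], and [b < 2 / pi] then gives [L q > 1]; positivity of [b] itself is
    [2 pi < L]. *)
Lemma gap_threshold_lt L (q : R) : (0 < L)%N -> 0 < 2 / pi - 4 / L%:R :> R ->
  gap_threshold R L < q ->
  [/\ 2 * pi <= L%:R :> R, 1 <= L%:R * q & 0 < ingham_lower L q].
Proof.
move=> L0 Ll; have LR : 0 < L%:R :> R by rewrite ltr0n.
have P0 := pi_gt0 R; rewrite /gap_threshold /ingham_lower.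
set b := 2 / pi - 4 / L%:R; move=> gap.
have L2 : 2 * pi <= L%:R :> R.
  move: Ll; rewrite subr_gt0 ltr_pdivrMr // mulrAC ltr_pdivlMr // => h.
  by lra.
have bpow : b `^ (- 2^-1) = (Num.sqrt b)^-1.
  by rewrite powRN powR12_sqrt // ltW.
have sq0 : 0 < Num.sqrt (2 / pi) / Num.sqrt b :> R.
  by rewrite divr_gt0 ?sqrtr_gt0 // divr_gt0.
have Lq : Num.sqrt (2 / pi) / Num.sqrt b < L%:R * q.
  by move: gap; rewrite bpow -mulrA mulrC ltr_pdivrMr // (mulrC q).
have Lq0 : 0 < L%:R * q by exact: lt_trans sq0 Lq.
have Lq2 : 2 / pi / b < (L%:R * q) ^+ 2.
  have := Lq; rewrite -(@ltr_pXn2r _ 2) ?nnegrE ?(ltW sq0) ?(ltW Lq0) //.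
  by rewrite exprMn exprVn !sqr_sqrtr // ?divr_ge0 // ltW.
have h : 2 / pi < (L%:R * q) ^+ 2 * b by rewrite -ltr_pdivrMr.
split=> //.
  rewrite -(@ler_pXn2r _ 2) ?nnegrE ?(ltW Lq0) // expr1n.
  have b2 : b < 2 / pi by rewrite /b ltrBlDr ltrDl divr_gt0.
  have c0 : 0 < 2 / pi :> R by rewrite divr_gt0.
  by move: (2 / pi) c0 b2 h => c c0 b2 h; nra.
rewrite (_ : _ - _ = b - 2 / pi / (L%:R * q) ^+ 2); last first.
  rewrite /b; move: (pi) P0 => p p0; field.
  by rewrite !gt_eqF // -(pmulr_rgt0 _ LR).
by rewrite subr_gt0 ltr_pdivrMr ?exprn_gt0 // (mulrC b).
Qed.

Lemma ingham_lower_le_upper L (q : R) : ingham_lower L q <= ingham_upper L q.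
Proof.
have P0 := pi_ge0 R; rewrite /ingham_lower /ingham_upper.
have D0 : 0 <= pi * L%:R ^+ 2 * q ^+ 2.
  by apply: mulr_ge0 (sqr_ge0 _); apply: mulr_ge0 (sqr_ge0 _).
have s1 : 1 <= Num.sqrt 2 :> R.
  by rewrite -[leLHS]sqrtr1 ler_wsqrtr // ler1n.
have : 0 <= Num.sqrt 2 / (pi * L%:R ^+ 2 * q ^+ 2) :> R.
  exact: divr_ge0 (sqrtr_ge0 _) D0.
have : 0 <= 2 / (pi * L%:R ^+ 2 * q ^+ 2) :> R.
  exact: divr_ge0 D0.
have : 0 <= 3 * Num.sqrt 2 / L%:R :> R.
  by rewrite divr_ge0 // mulr_ge0 // sqrtr_ge0.
have : 0 <= 4 / L%:R :> R by rewrite divr_ge0.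
have : 2 / pi <= 4 * Num.sqrt 2 / pi :> R.
  by rewrite ler_wpM2r ?invr_ge0 //; lra.
by lra.
Qed.

Lemma separation_le s (omega : 'I_s -> R) (j l : 'I_s) (n : int) : j != l ->
  separation omega <= `|omega j + n%:~R - omega l|.
Proof.
move=> jl; apply: (@le_trans _ _ (torus_dist (omega j) (omega l))).
  apply: ge_inf; last by exists (j, l).
  exists 0 => _ [[a b] _ <-]; apply: lb_le_inf.
    by exists `|omega a + 0%:~R - omega b|, 0.
  by move=> _ [m _ <-].
apply: ge_inf; last by exists n.
by exists 0 => _ [m _ <-].
Qed.

Lemma amp_min_le s (x : 'I_s -> C) j : amp_min x <= cmod (x j).
Proof.
apply: ge_inf; last by exists j.
by exists 0 => _ [l _ <-]; exact: cmod_ge0.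
Qed.

Lemma amp_min_ge0 s (x : 'I_s -> C) (j : 'I_s) : 0 <= amp_min x.
Proof.
apply: lb_le_inf; first by exists (cmod (x j)), j.
by move=> _ [l _ <-]; exact: cmod_ge0.
Qed.

Lemma amp_max_ge s (x : 'I_s -> C) j : cmod (x j) <= amp_max x.
Proof.
apply: ub_le_sup; last by exists j.
exists (\sum_l cmod (x l)) => _ [l _ <-].
by rewrite (bigD1 l) //= lerDl sumr_ge0 // => i _; exact: cmod_ge0.
Qed.

Lemma nsq_diag_ge s (x : 'I_s -> C) (y : 'cV[C]_s) :
  amp_min x ^+ 2 * nsq y <= nsq (diag_mx (\row_j x j) *m y).
Proof.
rewrite mulr_sumr; apply: ler_sum => j _.
rewrite mul_diag_mx !mxE cmodM exprMn ler_wpM2r ?sqr_ge0 //.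
by rewrite ler_pXn2r ?nnegrE ?cmod_ge0 ?(amp_min_ge0 x j) // amp_min_le.
Qed.

Lemma l2norm_steering_gt0 L (w : R) : 0 < l2norm (steering L w).
Proof.
rewrite sqrtr_gt0 /nsq big_ord_recl ltr_pwDl //.
  by rewrite mxE cmod_expm2pii expr1n.
by apply: sumr_ge0 => i _; exact: sqr_ge0.
Qed.

Lemma noise_corr01 L s (U : 'M[C]_L.+1) (w : R) :
  U \is unitarymx -> 0 <= noise_corr s U w <= 1.
Proof.
move=> Uu; have p0 := l2norm_steering_gt0 L w.
rewrite divr_ge0 ?l2norm_ge0 //= ler_pdivrMr // mul1r.
exact: l2norm_noise_proj_le.
Qed.

End Hankel.

(** * Stability of the noise-space correlation *)

Section NoiseCorrPerturbation.
Variable R : realType.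
Local Open Scope sesquilinear_scope.
Local Notation C := R[i].

Lemma ler_distl_max (p r c d b : R) :
  p <= r + c -> r <= p + d -> c <= b -> d <= b -> `|p - r| <= b.
Proof. by move=> *; rewrite ler_norml; apply/andP; split; lra. Qed.

Lemma ler_dist01 (p r : R) : 0 <= p <= 1 -> 0 <= r <= 1 -> `|p - r| <= 1.
Proof. by move=> *; rewrite ler_norml; apply/andP; split; lra. Qed.

Lemma noise_corr_le L s (U U' : 'M[C]_L.+1) (w b : R) :
  l2norm (noise_proj s U *m steering L w)
    <= l2norm (noise_proj s U' *m steering L w) + b * l2norm (steering L w) ->
  noise_corr s U w <= noise_corr s U' w + b.
Proof.
have p0 := l2norm_steering_gt0 L w; rewrite /noise_corr => h.
by rewrite ler_pdivrMr // mulrDl divfK ?gt_eqF.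
Qed.

(* [Q] stands for the adjoint of a Vandermonde factor of [H]: it makes the
   kernel of [H] large, while [H] is bounded below on the range of [Q^*]. *)
Lemma noise_corr_perturbation L n s (H E : 'M[C]_(L.+1, n))
    U sigma V Ue sigmae Ve (Q : 'M[C]_(s.+1, n)) (tau e w : R) :
  is_svd H U sigma V -> is_svd (H + E) Ue sigmae Ve ->
  (forall v : 'cV[C]_n, Q *m v = 0 -> H *m v = 0) ->
  (forall c : 'cV[C]_s.+1, c != 0 -> Q ^t* *m c != 0) ->
  (forall c : 'cV[C]_s.+1,
     tau * l2norm (Q ^t* *m c) <= l2norm (H *m (Q ^t* *m c))) ->
  (forall v : 'cV[C]_n, l2norm (E *m v) <= e * l2norm v) ->
  0 <= e -> e < tau ->
  `| noise_corr s.+1 Ue w - noise_corr s.+1 U w | <= 2 * e / (tau - e).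
Proof.
move=> svdH svdHe QH Qinj Htau Ee e0 e_tau.
have tau_e : 0 < tau - e by lra.
have tau0 : 0 < tau by lra.
(* Otherwise [Q ^t*] would have more columns than rows, hence a kernel. *)
have sn : (s < n)%N.
  rewrite ltnNge; apply/negP => ns.
  have [|c c0 Qc] := @exists_ker_vector _ _ _ (Q ^t*); first by rewrite ltnS.
  by have := Qinj c c0; rewrite Qc eqxx.
have sig : tau <= sigma s := singular_value_ge svdH Qinj Htau.
have sige : tau - e <= sigmae s.
  apply: (singular_value_ge svdHe Qinj) => c; rewrite mulrBl mulmxDl.
  have := Htau c; have := Ee (Q ^t* *m c).
  have := l2normD (H *m (Q ^t* *m c) + E *m (Q ^t* *m c)) (- (E *m (Q ^t* *m c))).
  by rewrite addrK l2normN; lra.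
(* On the kernel of [Q], which has codimension at most [s + 1], [H] vanishes and [H + E] agrees with
   [E]. *)
have sig0 k : (s < k)%N -> (k < L.+1)%N -> (k < n)%N -> sigma k <= 0.
  apply: (singular_value_le svdH (K := Q)) => v /QH ->.
  by rewrite l2norm0 mul0r.
have sige0 k : (s < k)%N -> (k < L.+1)%N -> (k < n)%N -> sigmae k <= e.
  apply: (singular_value_le svdHe (K := Q)) => v /QH Hv.
  by rewrite mulmxDl Hv add0r.
have EH (v : 'cV[C]_n) : l2norm ((H + E - H) *m v) <= e * l2norm v.
  by rewrite addrAC subrr add0r.
have HE (v : 'cV[C]_n) : l2norm ((H - (H + E)) *m v) <= e * l2norm v.
  by rewrite opprD addNKr mulNmx l2normN.
(* The two roles of [H] and [H + E] are asymmetric: the bounds are [e / (tau - e)] in one direction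
   and [2 e / tau] in the other, both at most [2 e / (tau - e)]. *)
have := noise_corr_le (noise_proj_perturbation (steering L w)
  svdH svdHe sn tau_e sige (lexx 0) sig0 EH e0).
have := noise_corr_le (noise_proj_perturbation (steering L w)
  svdHe svdH sn tau0 sig e0 sige0 HE e0).
have b1 : (e + e) / tau <= 2 * e / (tau - e).
  have -> : e + e = 2 * e by ring.
  by rewrite ler_wpM2l ?mulr_ge0 // lef_pV2 ?posrE //; lra.
have b2 : (0 + e) / (tau - e) <= 2 * e / (tau - e).
  by rewrite ler_wpM2r ?invr_ge0 ?(ltW tau_e) //; lra.
by move=> h1 h2; exact: ler_distl_max h1 h2 b1 b2.
Qed.

(** After clearing denominators this rests on [2 (a2 - e) <= 4 a1 + 2 e]. *)
Lemma perturbation_ratio_le (a1 a2 e : R) :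
  0 <= a2 -> a2 <= a1 -> 0 <= e -> e < a2 ->
  2 * e / (a2 - e) <= (4 * a1 + 2 * e) / (a2 - e) ^+ 2 * e.
Proof.
move=> a20 a21 e0 ea; have d0 : 0 < a2 - e by lra.
rewrite -subr_ge0.
have -> : (4 * a1 + 2 * e) / (a2 - e) ^+ 2 * e - 2 * e / (a2 - e)
  = e * (4 * a1 + 4 * e - 2 * a2) / (a2 - e) ^+ 2.
  by field; rewrite gt_eqF.
by rewrite divr_ge0 ?sqr_ge0 // mulr_ge0 //; lra.
Qed.

(** Here [(a2 - e)^2 <= e^2], which is at most the numerator [(4 a1 + 2 e) e]. *)
Lemma perturbation_ratio_ge1 (a1 a2 e : R) :
  0 <= a2 -> a2 <= a1 -> a2 <= e -> (a2 - e) ^+ 2 != 0 ->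
  1 <= (4 * a1 + 2 * e) / (a2 - e) ^+ 2 * e.
Proof.
move=> a20 a21 ae d0; have D0 : 0 < (a2 - e) ^+ 2 by rewrite lt0r d0 sqr_ge0.
by rewrite mulrAC ler_pdivlMr // mul1r; nra.
Qed.

End NoiseCorrPerturbation.

(** * The bound under the gap condition *)

Theorem corollary1 (R : realType) (s L M : nat)
    (omega : 'I_s -> R) (x : 'I_s -> R[i]) (eps : 'cV[R[i]]_M.+1)
    (U Ue : 'M[R[i]]_L.+1) (sigma sigmae : nat -> R)
    (V Ve : 'M[R[i]]_((M - L).+1))
    (s_ge2 : (2 <= s)%N) (L_gt0 : (1 <= L)%N) (L_lt_M : (L < M)%N)
    (L_even : ~~ odd L) (ML_even : ~~ odd (M - L))
    (omega01 : forall j : 'I_s, 0 <= omega j < 1)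
    (omega_inj : injective omega)
    (x_neq0 : forall j : 'I_s, x j != 0)
    (svdH : is_svd (hankel L (clean_data M omega x)) U sigma V)
    (svdHe : is_svd (hankel L (clean_data M omega x + eps)) Ue sigmae Ve)
    (L_large : 0 < 2 / pi - 4 / L%:R :> R)
    (ML_large : 0 < 2 / pi - 4 / (M - L)%:R :> R)
    (gap : Num.max (gap_threshold R L) (gap_threshold R (M - L))
             < separation omega) :
  let q := separation omega in
  let a1 := alpha1 L (M - L) q (amp_max x) in
  let a2 := alpha2 L (M - L) q (amp_min x) in
  let e := spectral_norm (hankel L eps) / Num.sqrt (L%:R * (M - L)%:R) in
  forall w : R, 0 <= w < 1 ->
    (a2 - e) ^+ 2 != 0 ->
    `| noise_corr s Ue w - noise_corr s U w |
      <= (4 * a1 + 2 * e) / (a2 - e) ^+ 2 * e.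
Proof.
destruct s as [|s]; first by [].
move=> q a1 a2 e w _ d0.
have N_gt0 : (0 < M - L)%N by rewrite subn_gt0.
move: gap; rewrite gt_max => /andP[gapL gapN].
have [L2 Lq lowL] := gap_threshold_lt L_gt0 L_large gapL.
have [N2 Nq lowN] := gap_threshold_lt N_gt0 ML_large gapN.
have sep (j l : 'I_s.+1) : j != l ->
    forall n : int, q <= `|omega j + n%:~R - omega l|.
  by move=> jl n; exact: separation_le.
have LR0 : 0 < L%:R :> R by rewrite ltr0n.
have NR0 : 0 < (M - L)%:R :> R by rewrite ltr0n.
pose j0 : 'I_s.+1 := ord0.
have xmin0 := amp_min_ge0 x j0.
have xminmax : amp_min x <= amp_max x.
  exact: le_trans (amp_min_le x j0) (amp_max_ge x j0).
have a20 : 0 <= a2 by rewrite mulr_ge0 ?sqrtr_ge0.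
have a21 : a2 <= a1.
  apply: ler_pM => //.
  by apply: ler_wsqrtr; apply: ler_pM; rewrite ?(ltW lowL) ?(ltW lowN) ?ingham_lower_le_upper.
have rt0 : 0 < Num.sqrt (L%:R * (M - L)%:R) :> R by rewrite sqrtr_gt0 mulr_gt0.
have e0 : 0 <= e by rewrite divr_ge0 ?spectral_norm_ge0 ?(ltW rt0).
have [ae|ea] := lerP a2 e.
  apply: le_trans (perturbation_ratio_ge1 a20 a21 ae d0).
  have [Uu _ _ _ _] := svdH; have [Uue _ _ _ _] := svdHe.
  exact: ler_dist01 (noise_corr01 s.+1 w Uue) (noise_corr01 s.+1 w Uu).
apply: le_trans (perturbation_ratio_le a20 a21 e0 ea).
(* Multiplying through by [rt] undoes the normalization of the noise and turns [a2] into
   [tau = a2 * rt]. *)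
pose rt := Num.sqrt (L%:R * (M - L)%:R : R).
have -> : 2 * e / (a2 - e) =
    2 * spectral_norm (hankel L eps) / (a2 * rt - spectral_norm (hankel L eps)).
  have -> : spectral_norm (hankel L eps) = e * rt by rewrite divfK // gt_eqF.
  by rewrite -mulrBl mulrA -mulf_div divff ?mulr1 // gt_eqF.
rewrite hankelD in svdHe.
have LM := ltnW L_lt_M.
pose mL := L%:R * ingham_lower L q; pose mN := (M - L)%:R * ingham_lower (M - L) q.
have mL0 : 0 < mL by rewrite mulr_gt0.
have mN0 : 0 < mN by rewrite mulr_gt0.
have tauE : a2 * rt = amp_min x * Num.sqrt (mL * mN).
  rewrite /a2 /alpha2 /rt -mulrA -sqrtrM ?mulr_ge0 ?(ltW lowL) ?(ltW lowN) //.
  by congr (_ * Num.sqrt _); rewrite /mL /mN -/q; ring.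
have Qge c := nsq_conj_vandermonde_ge sep c N_gt0 N2 Nq.
apply: (noise_corr_perturbation _ svdH svdHe (Q := (vandermonde (M - L) omega)^T)).
- by move=> v Qv; rewrite hankel_clean // -mulmxA Qv mulmx0.
- move=> c c0; apply/eqP => Qc; have := Qge c; rewrite Qc -(sqr_l2norm 0) l2norm0 expr0n /=.
  by rewrite leNgt mulr_gt0 // nsq_gt0.
- move=> c; rewrite tauE; set v := _ *m c.
  apply: ge_l2norm; first by rewrite mulr_ge0 ?sqrtr_ge0.
  (* For [v] in the range of the adjoint of [Q], this gives [|Q v|^2 >= mN |v|^2]; the amplitudes
     then contribute [amp_min x ^+ 2] and the left Vandermonde factor [mL]. *)
  have Qv := nsq_adjoint_ge mN0 (Qge c); rewrite -/v trmxCK in Qv.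
  rewrite hankel_clean // -!mulmxA exprMn sqr_sqrtr; last by rewrite mulr_ge0 ?ltW.
  apply: le_trans (nsq_vandermonde_ge sep _ L_gt0 L2 Lq).
  rewrite -/mL (_ : _ * nsq v = mL * (amp_min x ^+ 2 * (mN * nsq v))); last by ring.
  apply: ler_wpM2l; first exact: ltW.
  apply: le_trans (nsq_diag_ge _ _).
  by rewrite ler_wpM2l ?sqr_ge0.
- exact: l2norm_mulmx_le.
- exact: spectral_norm_ge0.
- by rewrite -ltr_pdivrMr.
Qed.
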